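(* Let $a<b$, $n\ge1$, let $B\in\mathbb{R}^{2n\times4n}$ have row rank $2n$, and let $B_a,B_b$ be the functions determined by $B$ as in the context. Let $M:[a,b]\to\mathbb{R}^{n\times n}$ and $N_1,N_2:[a,b]\times[a,b]\to\mathbb{R}^{n\times n}$. Suppose $x\in W^{3,2}[a,b]$ is $\mathbb{R}^n$-valued and $B\begin{bmatrix}x(a)^T&x(b)^T&x_s(a)^T&x_s(b)^T\end{bmatrix}^T=0$. Then $$\langle x,\mathcal{P}_{\{M,N_1,N_2\}}x_{s}\rangle_{L_2}=\langle x_{ss},\mathcal{P}_{\{0,Q_1,Q_2\}}x_{ss}\rangle_{L_2},$$ where $Q_1(s,\theta)=F_1(s,\theta)+F_3(s,\theta)$, $Q_2(s,\theta)=F_2(s,\theta)+F_3(s,\theta)$, and $$F_1(s,\theta)=\int_s^b\big((\eta-s)F_4(\theta,\eta)+F_5(s,\eta)\big)\,d\eta,$$ $$F_2(s,\theta)=\int_\theta^b\big((\eta-s)F_4(\theta,\eta)+F_5(s,\eta)\big)\,d\eta,$$ $$F_3(s,\eta)=\int_a^bB_a(\zeta,s)^TY_2(\zeta)B_b(\eta)\,d\zeta+\int_\eta^bY_1(s,\zeta)\,d\zeta+\int_s^b(\zeta-s)Y_2(\zeta)\,d\zeta\,B_b(\eta),$$ $$F_4(\theta,\eta)=M(\eta)+\int_\theta^\eta N_1(\eta,\zeta)\,d\zeta,\qquad F_5(s,\eta)=\int_s^\eta(\zeta-s)N_2(\zeta,\eta)\,d\zeta,$$ with $$Y_1(s,\eta)=B_a(\eta,s)^TM(\eta)+\int_\eta^bB_a(\theta,s)^TN_1(\theta,\eta)\,d\theta+\int_a^\eta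 B_a(\theta,s)^TN_2(\theta,\eta)\,d\theta,$$ $$Y_2(\zeta)=M(\zeta)+\int_a^\zeta N_1(\zeta,\theta)\,d\theta+\int_\zeta^bN_2(\zeta,\theta)\,d\theta .$$
   Context: The operator $\mathcal{P}_{\{M,N_1,N_2\}}:L_2^n[a,b]\to L_2^n[a,b]$ is $$(\mathcal{P}_{\{M,N_1,N_2\}}x)(s)=M(s)x(s)+\int_a^sN_1(s,\theta)x(\theta)\,d\theta+\int_s^bN_2(s,\theta)x(\theta)\,d\theta,$$ with $M,N_1,N_2$ regular enough (e.g. bounded measurable) that this is a well-defined operator on $L_2^n[a,b]$ and the integrals in the statement exist. $L_2^n[a,b]$ has the standard inner product $\langle x,y\rangle_{L_2}=\int_a^bx(s)^Ty(s)\,ds$. $x_s,x_{ss}$ are first and second derivatives in $s$. $W^{k,2}[a,b]$ is the Sobolev space of functions with derivatives up to order $k$ in $L_2$. Definition of $B_a,B_b$ (with $I,0$ being $n\times n$ blocks): $$B_2=B\begin{bmatrix} I & 0 \\ I & (b-a)I \\ 0 & I \\ 0 & I \end{bmatrix},\quad B_3=-B_2^{-1}B\begin{bmatrix} 0 & 0 \\ I & 0 \\ 0 & 0 \\ 0 & I \end{bmatrix},$$ $$\begin{bmatrix}B_4(s)&B_5(s)\end{bmatrix}=\begin{bmatrix}I&(s-a)I\end{bmatrix}B_3,\quad\begin{bmatrix}B_6&B_7\end{bmatrix}=\begin{bmatrix}0&I\end{bmatrix}B_3,$$ $$B_a(s,\eta)=B_4(s)(b-\eta)+B_5(s),\qquad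 B_b(\eta)=B_6(b-\eta)+B_7.$$ *)

(* Defs.v *)
(* Functions on [a, b] are represented by total functions on R
   of which only the values on [a, b] are used. *)
From HB Require Import structures.
From mathcomp Require Import all_boot all_order all_algebra.
From mathcomp Require Import all_classical all_reals all_analysis.
Set Implicit Arguments.
Unset Strict Implicit.
Unset Printing Implicit Defensive.
Import Order.TTheory GRing.Theory Num.Theory.
Import numFieldNormedType.Exports.
Local Open Scope classical_set_scope.
Local Open Scope ring_scope.

(* Entrywise Lebesgue integral of a matrix-valued function, oriented:
   mxint c d F = - mxint d c F when d < c. *)
Definition mxint (R : realType) p q (c d : R) (F : R -> 'M[R]_(p, q)) :
    'M[R]_(p, q) :=
  if c <= d then
    \matrix_(i, j) \int[@lebesgue_measure R]_(t in `[c, d]) F t i j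
  else - \matrix_(i, j) \int[@lebesgue_measure R]_(t in `[d, c]) F t i j.

Section Sobolev.
Context (R : realType) (n : nat) (a b : R).
Implicit Types x y : R -> 'cV[R]_n.

Definition in_L2 x : Prop :=
  forall i, (fun t => x t i 0) \_ `[a, b] \in Lfun (@lebesgue_measure R) 2%:E.

Definition inner_L2 x y : R :=
  \int[@lebesgue_measure R]_(t in `[a, b]) ((x t)^T *m y t) 0 0.

(* phi is of class C^1 with compact support in the open interval ]a, b[. *)
Definition test_function (phi : R -> R) : Prop :=
  [/\ forall t, derivable phi t 1,
      continuous (derive1 phi),
      compact (closure [set t | phi t != 0]) &
      closure [set t | phi t != 0] `<=` `]a, b[ ].

(* y is a representative of the weak derivative of x, and lies in L_2; C^1 test
   functions are used as in Brezis, Functional Analysis, Sobolev Spaces and PDEs,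
   Chapter 8. *)
Definition weak_derivative x y : Prop :=
  in_L2 y /\
  forall phi, test_function phi ->
    mxint a b (fun t => derive1 phi t *: x t) = - mxint a b (fun t => phi t *: y t).

(* W^{k,2}[a, b]. *)
Fixpoint sobolev (k : nat) x : Prop :=
  match k with
  | O => in_L2 x
  | S k' => in_L2 x /\ exists y, weak_derivative x y /\ sobolev k' y
  end.

End Sobolev.

Section BoundaryMatrices.
Context (R : realType) (n : nat) (a b : R) (B : 'M[R]_(n + n, n + (n + (n + n)))).

Definition B2 : 'M[R]_(n + n) :=
  B *m col_mx (row_mx 1%:M 0)
      (col_mx (row_mx 1%:M (b - a)%:M)
      (col_mx (row_mx 0 1%:M)
              (row_mx 0 1%:M))).

(* Only meaningful when B2 is invertible. *)
Definition B3 : 'M[R]_(n + n) :=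
  - (invmx B2 *m B *m
     col_mx (row_mx 0 0)
    (col_mx (row_mx 1%:M 0)
    (col_mx (row_mx 0 0)
            (row_mx 0 1%:M)))).

Definition B4 (s : R) : 'M[R]_n := lsubmx (row_mx 1%:M (s - a)%:M *m B3).
Definition B5 (s : R) : 'M[R]_n := rsubmx (row_mx 1%:M (s - a)%:M *m B3).
Definition B6 : 'M[R]_n := lsubmx (row_mx 0 1%:M *m B3).
Definition B7 : 'M[R]_n := rsubmx (row_mx 0 1%:M *m B3).

Definition Ba (s eta : R) : 'M[R]_n := (b - eta) *: B4 s + B5 s.
Definition Bb (eta : R) : 'M[R]_n := (b - eta) *: B6 + B7.

End BoundaryMatrices.

Section PIOperators.
Context (R : realType) (n : nat) (a b : R).
Implicit Types (M : R -> 'M[R]_n) (N : R -> R -> 'M[R]_n).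

Definition pi_op M N1 N2 (x : R -> 'cV[R]_n) (s : R) : 'cV[R]_n :=
  M s *m x s + mxint a s (fun theta => N1 s theta *m x theta)
             + mxint s b (fun theta => N2 s theta *m x theta).

Definition bounded_measurable1 M : Prop :=
  (forall i j, measurable_fun `[a, b] (fun s => M s i j)) /\
  exists C : R, forall s, s \in `[a, b] -> forall i j, `|M s i j| <= C.

Definition bounded_measurable2 N : Prop :=
  (forall i j, measurable_fun (`[a, b] `*` `[a, b])
     (fun z : R * R => N z.1 z.2 i j)) /\
  exists C : R, forall s theta, s \in `[a, b] -> theta \in `[a, b] ->
    forall i j, `|N s theta i j| <= C.

End PIOperators.

Section Kernels.
Context (R : realType) (n : nat) (a b : R) (B : 'M[R]_(n + n, n + (n + (n + n)))).
Context (M : R -> 'M[R]_n) (N1 N2 : R -> R -> 'M[R]_n).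

Local Notation Ba := (Ba a b B).
Local Notation Bb := (Bb a b B).

Definition Y1 (s eta : R) : 'M[R]_n :=
  (Ba eta s)^T *m M eta
  + mxint eta b (fun theta => (Ba theta s)^T *m N1 theta eta)
  + mxint a eta (fun theta => (Ba theta s)^T *m N2 theta eta).

Definition Y2 (zeta : R) : 'M[R]_n :=
  M zeta + mxint a zeta (fun theta => N1 zeta theta)
         + mxint zeta b (fun theta => N2 zeta theta).

Definition F4 (theta eta : R) : 'M[R]_n :=
  M eta + mxint theta eta (fun zeta => N1 eta zeta).

Definition F5 (s eta : R) : 'M[R]_n :=
  mxint s eta (fun zeta => (zeta - s) *: N2 zeta eta).

Definition F1 (s theta : R) : 'M[R]_n :=
  mxint s b (fun eta => (eta - s) *: F4 theta eta + F5 s eta).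

Definition F2 (s theta : R) : 'M[R]_n :=
  mxint theta b (fun eta => (eta - s) *: F4 theta eta + F5 s eta).

Definition F3 (s eta : R) : 'M[R]_n :=
  mxint a b (fun zeta => (Ba zeta s)^T *m Y2 zeta *m Bb eta)
  + mxint eta b (fun zeta => Y1 s zeta)
  + mxint s b (fun zeta => (zeta - s) *: Y2 zeta) *m Bb eta.

Definition Q1 (s theta : R) : 'M[R]_n := F1 s theta + F3 s theta.
Definition Q2 (s theta : R) : 'M[R]_n := F2 s theta + F3 s theta.

End Kernels.

(* Main.v *)
(* Put u = x_ss.  Taylor's formula and the boundary conditions give
     x(s) = int_a^b ([e <= s] (s - e) + B_a(s, e)) u(e) de,
     x_s(s) = int_a^b ([e <= s] + B_b(e)) u(e) de,
   where [e <= s] is 0 or 1.  Substituting these in <x, P x_s> and applying Fubini's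
   theorem yields <u, int_a^b K(., e) u(e) de> for one kernel K, and a further use of
   Fubini's theorem identifies K with Q_1 below the diagonal and Q_2 above it.
   Taylor's formula for the continuous representatives comes from the du Bois-Reymond
   lemma: a continuous function with zero weak derivative is constant. *)
Require Import Defs.
From mathcomp Require Import all_boot all_order all_algebra.
From mathcomp Require Import all_classical all_reals all_analysis.
From mathcomp Require Import measurable_realfun ring lra.
Import Order.TTheory GRing.Theory Num.Theory.
Import numFieldNormedType.Exports.
Local Open Scope classical_set_scope.
Local Open Scope ring_scope.
Set Implicit Arguments.
Unset Strict Implicit.
Unset Printing Implicit Defensive.

(** * Bounded measurable functions and Fubini's theorem *)

(** The function u is merely integrable, whereas all kernels are bounded and measurable. Kernels are
    therefore kept in a class closed under sums, products, substitution of variables and integration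
    in a parameter, and every exchange of integrals pairs a bounded kernel with an integrable
    factor. Moving limits of integration become 0-1 factors on the fixed interval, hence part of the
    kernel. The test functions for the du Bois-Reymond lemma are explicit: second differences of
    t|t| are of class C^1 and their derivatives are hats of known mass, so values of a continuous
    function can be compared locally without mollifiers. A single formula covers both sides of the
    diagonal because F_1 and F_2 are the same integral with lower limit max(s, theta). *)

Section BoundedMeasurable.
Context {R : realType}.

Definition bounded_measurable {d} {T : measurableType d} (D : set T)
    (f : T -> R) : Prop :=
  measurable_fun D f /\ exists C : R, forall t, D t -> `|f t| <= C.

Context {d : measure_display} {T : measurableType d}.
Implicit Types (D : set T) (f g : T -> R).

Lemma bounded_measurable_cst D (c : R) : bounded_measurable D (fun=> c).
Proof. by split; [exact: measurable_cst | exists `|c|]. Qed.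

Lemma eq_bounded_measurable D f g : {in D, f =1 g} ->
  bounded_measurable D f -> bounded_measurable D g.
Proof.
move=> fg [mf [C fC]]; split; first exact: eq_measurable_fun fg mf.
by exists C => t Dt; rewrite -fg ?inE//; exact: fC.
Qed.

Lemma bounded_measurableD D f g : bounded_measurable D f ->
  bounded_measurable D g -> bounded_measurable D (fun t => f t + g t).
Proof.
move=> [mf [C fC]] [mg [C' gC]]; split; first exact: measurable_funD.
exists (C + C') => t Dt; apply: le_trans (ler_normD _ _) _.
by apply: lerD; [exact: fC | exact: gC].
Qed.

Lemma bounded_measurableM D f g : bounded_measurable D f ->
  bounded_measurable D g -> bounded_measurable D (fun t => f t * g t).
Proof.
move=> [mf [C fC]] [mg [C' gC]]; split; first exact: measurable_funM.
exists (C * C') => t Dt; rewrite normrM.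
by apply: ler_pM => //; [exact: fC | exact: gC].
Qed.

Lemma bounded_measurable_sum (I : Type) (r : seq I) D (F : I -> T -> R) :
  (forall i, bounded_measurable D (F i)) ->
  bounded_measurable D (fun t => \sum_(i <- r) F i t).
Proof.
move=> bF; elim: r => [|i r IH].
  by apply: eq_bounded_measurable (bounded_measurable_cst D 0) => t _; rewrite big_nil.
apply: eq_bounded_measurable (bounded_measurableD (bF i) IH) => t _.
by rewrite big_cons.
Qed.

(** These 0-1 factors encode variable limits of integration and the Volterra parts of the
    kernels. *)
Lemma bounded_measurable_le D f g : measurable_fun D f -> measurable_fun D g ->
  bounded_measurable D (fun t => (f t <= g t)%R%:R).
Proof.
move=> mf mg; split.
  have := measurable_fun_ler mf mg.
  move=> m; have -> : (fun t => (f t <= g t)%R%:R) =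
      (fun b : bool => b%:R : R) \o (fun t => (f t <= g t)%R) by [].
  exact: measurableT_comp.
by exists 1 => t _; rewrite normr_nat -[leRHS]/(1%:R) ler_nat leq_b1.
Qed.

Lemma bounded_measurable_comp d' (T' : measurableType d') D (E : set T')
    (f : T' -> R) (g : T -> T') :
  measurable E -> measurable_fun [set: T] g -> (forall t, D t -> E (g t)) ->
  measurable D ->
  bounded_measurable E f -> bounded_measurable D (fun t => f (g t)).
Proof.
move=> mE mg DE mD [mf [C fC]]; split; last by exists C => t /DE; exact: fC.
apply: (measurable_comp mE _ mf); first by move=> _ [t Dt <-]; exact: DE.
exact: measurable_funS mg.
Qed.

End BoundedMeasurable.

(** * Integrals depending on a parameter, and the exchange of integrals *)

Section Parametric.
Context {R : realType} (a b : R).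
Local Notation mu := (@lebesgue_measure R).
Local Notation I := (`[a, b]%classic : set R).

Lemma bounded_measurable_integrable (f : R -> R) : bounded_measurable I f ->
  mu.-integrable I (EFin \o f).
Proof.
move=> [mf [C fC]]; apply: measurable_bounded_integrable => //.
  by rewrite /= lebesgue_measure_itv/=; case: ifP => //; rewrite -EFinD ltry.
exists C; split; first exact: num_real.
by move=> M CM t It; exact: le_trans (fC _ It) (ltW CM).
Qed.

Lemma integrable_bounded_measurableM (f u : R -> R) : bounded_measurable I f ->
  mu.-integrable I (EFin \o u) -> mu.-integrable I (EFin \o (fun t => f t * u t)).
Proof.
move=> [mf [C fC]] iu; have /integrableP[mu' _] := iu.
have iCu : mu.-integrable I (fun t => C%:E * (u t)%:E)%E by exact: integrableZl.
apply: le_integrable iCu => //.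
  apply/measurable_EFinP; apply: measurable_funM => //.
  exact/measurable_EFinP.
move=> t It /=; rewrite lee_fin !normrM ler_wpM2r//.
by rewrite (le_trans (fC _ It))// ler_norm.
Qed.

Context {d : measure_display} {T : measurableType d}.

(** The bound is [C] times the L_1 norm of [u]; measurability comes from Tonelli's theorem. *)
Lemma bounded_measurable_integral (D : set T) (f : T * R -> R) (u : R -> R) :
  measurable D -> bounded_measurable (D `*` I) f ->
  mu.-integrable I (EFin \o u) ->
  bounded_measurable D (fun z => \int[mu]_(t in I) (f (z, t) * u t)).
Proof.
move=> mD bf iu; have mDI : measurable (D `*` I) by exact: measurableX.
have bs z : D z -> bounded_measurable I (fun t => f (z, t)).
  move=> Dz; apply: (bounded_measurable_comp mDI) bf => //.
have /integrableP[mu' _] := iu.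
have mu1 : measurable_fun I u by exact/measurable_EFinP.
split; last first.
  have [_ [C fC]] := bf; exists (C * \int[mu]_(t in I) `|u t|) => z Dz.
  have iu' := integrable_norm iu.
  rewrite -RintegralZl//.
  have ifu := integrable_bounded_measurableM (bs _ Dz) iu.
  apply: (le_trans (le_normr_Rintegral _ ifu)) => //.
  apply: le_Rintegral => //.
  - exact: (integrable_norm ifu).
  - suff : mu.-integrable I (fun t => C%:E * (`|u t|)%:E)%E by [].
    exact: integrableZl.
  by move=> t It; rewrite normrM ler_wpM2r//; apply: fC.
(* Extension by zero makes the partial integrals functions on the whole space. *)
pose g := (fun p : T * R => f p * u p.2) \_ (D `*` I).
have mg : measurable_fun setT g.
  have mfu : measurable_fun (D `*` I) (fun p : T * R => f p * u p.2).
    apply: measurable_funM; first by case: bf.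
    apply: (measurable_comp (F := I)) => //; first by move=> _ [[z t] [_ It] <-].
    apply: measurable_funS (measurable_snd); [exact: measurableT|by []].
  exact/(measurable_restrictT _ mDI).
(* Tonelli's theorem concerns nonnegative functions, so the two signs are treated apart and
   subtracted. *)
have mpos : measurable_fun setT (fubini_F mu (EFin \o g)^\+%E).
  apply: measurable_fun_fubini_tonelli_F => //.
  by apply: measurable_funepos; exact/measurable_EFinP.
have mneg : measurable_fun setT (fubini_F mu (EFin \o g)^\-%E).
  apply: measurable_fun_fubini_tonelli_F => //.
  by apply: measurable_funeneg; exact/measurable_EFinP.
have m := emeasurable_funB mpos mneg.
have {}m : measurable_fun D (fun z => fine (\int[mu]_t (g (z, t))%:E)%E).
  apply: measurable_funS (measurableT) _ _ => //.
  apply: (measurableT_comp (fine_measurable _)) => //.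
  apply: eq_measurable_fun m => z _ /=.
  rewrite [RHS]integralE; congr (_ - _)%E; apply: eq_integral => t _;
    by rewrite ?funeposE ?funenegE.
apply: eq_measurable_fun m => z; rewrite inE => Dz.
rewrite Rintegral_mkcond /Rintegral; congr fine; apply: eq_integral => t _.
rewrite /g !patchE; congr EFin.
by rewrite in_setX /= (mem_set Dz).
Qed.

Lemma Fubini_Rintegral (f : R * R -> R) (u : R -> R) :
  bounded_measurable (I `*` I) f -> mu.-integrable I (EFin \o u) ->
  \int[mu]_(s in I) \int[mu]_(t in I) (f (s, t) * u t)
  = \int[mu]_(t in I) ((\int[mu]_(s in I) f (s, t)) * u t).
Proof.
move=> bf iu; have mDI : measurable (I `*` I) by exact: measurableX.
have /integrableP[mu' _] := iu.
have mu1 : measurable_fun I u by exact/measurable_EFinP.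
pose g := (fun p : R * R => f p * u p.2) \_ (I `*` I).
have mg : measurable_fun setT g.
  have mfu : measurable_fun (I `*` I) (fun p : R * R => f p * u p.2).
    apply: measurable_funM; first by case: bf.
    apply: (measurable_comp (F := I)) => //; first by move=> _ [[z t] [_ It] <-].
    apply: measurable_funS (measurable_snd); [exact: measurableT|by []].
  exact/(measurable_restrictT _ mDI).
have ig : (mu \x mu)%E.-integrable setT (EFin \o g).
  apply/integrable12ltyP; first exact/measurable_EFinP.
  have [_ [C fC]] := bf.
  (* The integrand is dominated by the indicator of [I] in [s] times [|C * u t|]. [K] is the mass of
     the latter, so the double integral is at most the finite measure of [I] times [K]. *)
  pose K := (\int[mu]_(t in I) `|(C * u t)%:E|)%E.
  have Kfin : (K < +oo)%E.
    have iCu : mu.-integrable I (fun t => C%:E * (u t)%:E)%E by exact: integrableZl.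
    by have /integrableP[_] := iCu.
  apply: (@le_lt_trans _ _ (\int[mu]_s ((\1_I s)%:E * K))%E).
    apply: ge0_le_integral => //.
    - by move=> s _; exact: integral_ge0.
    - have mF : measurable_fun setT (fubini_F mu (abse \o (EFin \o g))).
        apply: measurable_fun_fubini_tonelli_F => //=.
        by apply: measurableT_comp => //; exact/measurable_EFinP.
      exact: mF.
    - apply: emeasurable_funM => //; apply/measurable_EFinP.
      exact: measurable_indic.
    move=> s _; rewrite indicE; have [Is|nIs] := boolP (s \in I); last first.
      rewrite mul0e integral0_eq// => t _; rewrite /= /g patchE in_setX /=.
      by rewrite (negbTE nIs)/= normr0.
    rewrite mul1e /K [leRHS]integral_mkcond; apply: ge0_le_integral => //.
    - apply: measurableT_comp => //; apply/measurable_EFinP.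
      exact: measurableT_comp mg (pair1_measurable s).
    - apply/(measurable_restrictT _ (measurable_itv _)).
      apply: measurableT_comp => //; apply/measurable_EFinP.
      exact: measurable_funM.
    move=> t _; rewrite /g /= !patchE in_setX /= Is /=.
    case: ifPn => [It|]; last by rewrite normr0.
    rewrite lee_fin !normrM ler_wpM2r// (le_trans (fC _ _)) ?ler_norm//.
    by split; rewrite /= -in_setE.
  rewrite ge0_integralZr//; last 2 first.
  - by apply/measurable_EFinP; exact: measurable_indic.
  - exact: integral_ge0.
  rewrite integral_indic// setIT /= lebesgue_measure_itv/=.
  rewrite lte_mul_pinfty//; case: ifP => // ab; rewrite -EFinD ?lee_fin//.
  by rewrite subr_ge0 ltW.
(* The real and the extended inner integrals agree because the sections are integrable. *)
have inn1 s : s \in I -> (\int[mu]_(t in I) (f (s, t) * u t))%:E =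
    (\int[mu]_t (g (s, t))%:E)%E.
  move=> Is; rewrite /Rintegral fineK; last first.
    apply: integrable_fin_num => //; apply: integrable_bounded_measurableM iu.
    apply: (bounded_measurable_comp mDI) bf => //.
    by move=> t It; split => //=; rewrite -in_setE.
  rewrite integral_mkcond.
  by apply: eq_integral => t _; rewrite /g !patchE in_setX /= Is; case: ifP.
have inn2 t : t \in I -> ((\int[mu]_(s in I) f (s, t)) * u t)%:E =
    (\int[mu]_s (g (s, t))%:E)%E.
  move=> It.
  have ift : mu.-integrable I (EFin \o (fun s => f (s, t))).
    apply: bounded_measurable_integrable.
    apply: (bounded_measurable_comp mDI) bf => //.
    by move=> s Is; split => //=; rewrite -in_setE.
  rewrite -RintegralZr// /Rintegral fineK; last first.
    have ifu : mu.-integrable I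
        ((EFin \o (fun s => f (s, t))) \* cst (u t)%:E)%E by exact: integrableZr.
    exact: integrable_fin_num ifu.
  rewrite integral_mkcond.
  by apply: eq_integral => s _; rewrite /g !patchE in_setX /= It andbT; case: ifP.
congr fine.
rewrite integral_mkcond [RHS]integral_mkcond.
transitivity (\int[mu]_s \int[mu]_t (g (s, t))%:E)%E.
  apply: eq_integral => s _; rewrite patchE; case: ifPn => [/inn1//|nIs].
  by rewrite integral0_eq// => t _; rewrite /= /g patchE in_setX /= (negbTE nIs).
rewrite (Fubini ig); apply: eq_integral => t _; rewrite patchE.
case: ifPn => [/inn2//|nIt].
by rewrite integral0_eq// => s _; rewrite /= /g patchE in_setX /= (negbTE nIt) andbF.
Qed.

End Parametric.

(** * Weak derivatives *)

Section C1Functions.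
Context {R : realType}.
Local Notation mu := (@lebesgue_measure R).

Lemma is_derive_quadratic_error (f : R -> R) (t L C : R) :
  (forall k, `|f (t + k) - f t - L * k| <= C * k ^+ 2) -> is_derive t 1 f L.
Proof.
move=> fL.
(* The case [k = 1] of the hypothesis gives [0 <= C]; adding 1 allows division when [C = 0]. *)
have C1 : 0 < C + 1.
  rewrite ltr_wpDl//; have := fL 1; rewrite expr1n !mulr1; exact: le_trans (normr_ge0 _).
have H : (fun k => k^-1 *: (f (k *: 1 + t) - f t)) @ 0^' --> L.
  apply/cvgrPdist_le => e e0.
  near=> k.
  have k0 : k != 0 by near: k; exact: nbhs_dnbhs_neq.
  have -> : L - k^-1 *: (f (k *: 1 + t) - f t) =
      - (k^-1 * (f (t + k) - f t - L * k)).
    by rewrite /GRing.scale/= mulr1 [k + t]addrC; field.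
  rewrite normrN normrM normfV ler_pdivrMl ?normr_gt0//.
  apply: le_trans (fL k) _.
  rewrite -(real_normK (num_real k)) expr2 mulrA [_ * e]mulrC.
  rewrite ler_wpM2r//.
  have : `|k| <= (C + 1)^-1 * e.
    near: k; have Ce : 0 < (C + 1)^-1 * e by rewrite mulr_gt0 ?invr_gt0.
    exact: (@dnbhs0_le _ R^o _ Ce).
  rewrite ler_pdivlMl// mulrDl mul1r; have := normr_ge0 k; lra.
apply: DeriveDef; first by apply/cvg_ex; exists L.
by apply/cvg_lim.
Unshelve. all: by end_near. Qed.

Lemma Rintegral_derive1 (F : R -> R) (c d : R) : c <= d ->
  (forall t, derivable F t 1) -> continuous (derive1 F) ->
  \int[mu]_(t in `[c, d]) derive1 F t = F d - F c.
Proof.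
rewrite le_eqVlt => /predU1P[->|cd] dF cF'.
  by rewrite set_itv1 Rintegral_set1 subrr.
have cF : continuous F.
  by move=> t; apply/differentiable_continuous/derivable1_diffP.
have LR : derivable_oo_LRcontinuous F c d.
  split; first by move=> t _; exact: dF.
    by apply: cvg_at_right_filter; exact: cF.
  by apply: cvg_at_left_filter; exact: cF.
by rewrite /Rintegral (continuous_FTC2 cd (continuous_subspaceT cF') LR (fun _ _ => erefl)).
Qed.

(** A C^1 primitive of [2|t|]. *)
Definition sgsqr (t : R) : R := t * `|t|.

(* The second difference of sgsqr: of class C^1 and constant on each side of [-h, h]. *)
Definition step (h t : R) : R := sgsqr (t + h) - sgsqr t *+ 2 + sgsqr (t - h).

(** The derivative of [step h]: for [h > 0], a hat of height [4h] on [-h, h]. *)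
Definition tent (h t : R) : R := (`|t + h| - `|t| *+ 2 + `|t - h|) *+ 2.

Lemma sgsqr_error (t k : R) : `|sgsqr (t + k) - sgsqr t - `|t| *+ 2 * k| <= k ^+ 2.
Proof.
rewrite /sgsqr ler_norml; case: (ger0P t) => ht; case: (ger0P (t + k)) => hk;
  apply/andP; split; nra.
Qed.

(** The constant 4 is 1 + 2 + 1, the sum of the absolute weights of the second difference. *)
Lemma step_error (h t k : R) :
  `|step h (t + k) - step h t - tent h t * k| <= 4 * k ^+ 2.
Proof.
have := sgsqr_error (t + h) k; have := sgsqr_error t k.
have := sgsqr_error (t - h) k; rewrite /step /tent.
rewrite [t - h + k]addrAC [t + h + k]addrAC !ler_norml.
by move=> /andP[? ?] /andP[? ?] /andP[? ?]; apply/andP; split; lra.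
Qed.

Lemma tent_ge0 (h t : R) : 0 <= tent h t.
Proof.
rewrite /tent mulrn_wge0// -mulr_natr.
have := ler_normD (t + h) (t - h); rewrite addrACA subrr addr0 -mulr2n normrMn.
lra.
Qed.

Lemma tent_out (h t : R) : 0 <= h -> h <= `|t| -> tent h t = 0.
Proof.
rewrite /tent => h0; case: (ger0P t) => t0 ht.
  by rewrite !ger0_norm; lra.
by rewrite !ler0_norm; lra.
Qed.

Lemma step_right (h t : R) : 0 <= h -> h <= t -> step h t = h ^+ 2 *+ 2.
Proof. by move=> h0 ht; rewrite /step /sgsqr !ger0_norm; lra. Qed.

Lemma step_left (h t : R) : 0 <= h -> t <= - h -> step h t = - (h ^+ 2 *+ 2).
Proof. by move=> h0 ht; rewrite /step /sgsqr !ler0_norm; lra. Qed.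

Lemma continuous_tent (h c : R) : continuous (fun t => tent h (t - c)).
Proof.
have cn (e : R) : continuous (fun t : R => `|t - c + e|).
  move=> t; apply: (@continuous_comp _ _ _ (fun t => t - c + e) Num.norm).
    by apply: cvgD; [apply: cvgB; [exact: cvg_id|exact: cvg_cst]|exact: cvg_cst].
  exact: norm_continuous.
(* The shift by 0 brings the middle terms to the form treated by [cn]. *)
pose f t : R := `|t - c + h| - (`|t - c + 0| + `|t - c + 0|) + `|t - c - h|.
have -> : (fun t => tent h (t - c)) = (fun t => f t + f t).
  by apply/funext => t; rewrite /tent /f addr0 !mulr2n.
move=> t; have cf : f @ t --> f t.
  apply: cvgD; last exact: cn.
  by apply: cvgB; [exact: cn|apply: cvgD; exact: cn].
exact: cvgD.
Qed.

Lemma is_derive_step (h c t : R) :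
  is_derive t 1 (fun t => step h (t - c)) (tent h (t - c)).
Proof.
apply: (@is_derive_quadratic_error (fun t => step h (t - c)) _ _ 4) => k.
by rewrite [t + k - c]addrAC; exact: step_error.
Qed.

Lemma derive1_step (h c : R) :
  derive1 (fun t => step h (t - c)) = (fun t => tent h (t - c)).
Proof.
by apply/funext => t; rewrite derive1E; have [_ ->] := is_derive_step h c t.
Qed.

End C1Functions.

(** * The du Bois-Reymond lemma and primitives of weak derivatives *)

Section DuBoisReymond.
Context {R : realType} (a b : R) (hab : a < b).
Local Notation mu := (@lebesgue_measure R).
Local Notation I := (`[a, b]%classic : set R).

(** Over [a, b] the primitive [step] climbs from [-2h^2] to [2h^2]. *)
Lemma integral_tent (h c : R) : 0 <= h -> a <= c - h -> c + h <= b ->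
  \int[mu]_(t in I) tent h (t - c) = h ^+ 2 *+ 4.
Proof.
move=> h0 ach chb.
have dstep t : derivable (fun t => step h (t - c)) t 1.
  by have [] := is_derive_step h c t.
have cstep : continuous (derive1 (fun t => step h (t - c))).
  by rewrite derive1_step; exact: continuous_tent.
have := Rintegral_derive1 (ltW hab) dstep cstep.
rewrite derive1_step => ->; rewrite step_right//; last by lra.
by rewrite step_left//; lra.
Qed.

(** A single [step] does not vanish away from its hat, but two translates of equal width have the
    same constants on either side, so their difference has compact support. *)
Lemma test_function_step (h c d : R) : 0 < h ->
  a < c - h -> c + h < b -> a < d - h -> d + h < b ->
  test_function a b (fun t => step h (t - c) - step h (t - d)) /\
  derive1 (fun t => step h (t - c) - step h (t - d)) =
    (fun t => tent h (t - c) - tent h (t - d)).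
Proof.
move=> h0 ac cb ad db; set phi := fun t => _.
have dphi (t : R) : is_derive t 1 phi (tent h (t - c) - tent h (t - d)).
  by apply: is_deriveB; exact: is_derive_step.
have phi' : derive1 phi = (fun t => tent h (t - c) - tent h (t - d)).
  by apply/funext => t; rewrite derive1E; have [_ ->] := dphi t.
pose J : set R := `[Num.min c d - h, Num.max c d + h]%classic.
have clJ : closure [set t | phi t != 0] `<=` J.
  rewrite [J](closure_id _).1; last exact: interval_closed.
  apply: closureS => t /=; apply: contra_neqP; rewrite /J /= in_itv/= => tJ.
  have [tl|tl] := leP t (Num.min c d - h).
    have ? : t <= c - h by rewrite (le_trans tl)// lerD2r ge_min lexx.
    have ? : t <= d - h by rewrite (le_trans tl)// lerD2r ge_min lexx orbT.
    by rewrite /phi !step_left ?subrr//; lra.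
  have [tr|tr] := leP (Num.max c d + h) t.
    have ? : c + h <= t by rewrite (le_trans _ tr)// lerD2r le_max lexx.
    have ? : d + h <= t by rewrite (le_trans _ tr)// lerD2r le_max lexx orbT.
    by rewrite /phi !step_right ?subrr//; lra.
  by exfalso; apply: tJ; rewrite !ltW.
split => //; split.
- by move=> t; have [] := dphi t.
- by rewrite phi' => t; apply: cvgB; exact: continuous_tent.
- apply: (subclosed_compact _ (@segment_compact _ _ _) clJ).
  exact: closed_closure.
- apply: subset_trans clJ _ => t; rewrite /J /= !in_itv/= => /andP[tl tr].
  apply/andP; split.
    by rewrite (lt_le_trans _ tl)// ltrBrDr lt_min -!ltrBrDr ac ad.
  by rewrite (le_lt_trans tr)// -ltrBrDr gt_max !ltrBrDr cb db.
Qed.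

Lemma continuous_bounded_measurable (f : R -> R) : {within I, continuous f} ->
  bounded_measurable I f.
Proof.
move=> cf; split; first by apply: subspace_continuous_measurable_fun.
have cnf : {within I, continuous (fun t => `|f t|)}.
  by move=> t; apply: cvg_norm; exact: cf.
have [x _ xmax] := EVT_max (ltW hab) cnf.
by exists `|f x| => t tI; exact: xmax.
Qed.

(** The point [c] may be an endpoint of [a, b], where no hat fits; a nearby interior centre [c']
    replaces it. *)
Lemma interior_interval (g : R -> R) (c m : R) : {within I, continuous g} ->
  c \in `[a, b] -> g c < m ->
  exists c' h, [/\ 0 < h, a < c' - h, c' + h < b &
    forall t, `|t - c'| <= h -> g t < m].
Proof.
move=> cg cI gm.
have /subspace_continuousP /(_ c cI) gc := cg.
have : \forall t \near within I (nbhs c), g t < m.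
  exact: (cvgr_lt _ gc _ gm).
rewrite near_withinE => /nbhs_ballP[e /= e0 He].
have {}cI := cI; rewrite in_itv/= in cI; have /andP[ac cb] := cI.
pose lo := Num.max a (c - e); pose hi := Num.min b (c + e).
have ? : a <= lo by rewrite le_max lexx.
have ? : c - e <= lo by rewrite le_max lexx orbT.
have ? : hi <= b by rewrite ge_min lexx.
have ? : hi <= c + e by rewrite ge_min lexx orbT.
have lohi : lo < hi.
  by rewrite lt_min !gt_max hab/=; apply/and3P; split; lra.
(* A quarter of the length around the midpoint stays strictly inside ]lo, hi[. *)
exists ((lo + hi) / 2), ((hi - lo) / 4); split; [lra|lra|lra|].
move=> t; rewrite ler_norml => /andP[t1 t2]; apply: He.
  by rewrite /ball/= ltr_norml; apply/andP; split; lra.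
by rewrite /= in_itv/=; apply/andP; split; lra.
Qed.

(** If [g] took a smaller value at one point than at another, equal hats near the two points would
    give different averages of [g], while testing with the difference of their primitives forces
    these averages to agree. The points are arbitrary, so the inequality also holds with them
    exchanged and [g] is constant. *)
Lemma zero_weak_derivative_le (g : R -> R) : {within I, continuous g} ->
  (forall phi, test_function a b phi ->
    \int[mu]_(t in I) (derive1 phi t * g t) = 0) ->
  forall c d, c \in `[a, b] -> d \in `[a, b] -> g c <= g d.
Proof.
move=> cg g0 d c dI cI; rewrite leNgt; apply/negP => gcd.
have cI' : mu.-integrable I (EFin \o g).
  exact: continuous_compact_integrable (@segment_compact _ _ _) cg.
have ing (h e : R) : mu.-integrable I (EFin \o (fun t => tent h (t - e))).
  apply: continuous_compact_integrable; first exact: segment_compact.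
  exact/continuous_subspaceT/continuous_tent.
(* The thirds of the gap leave [g < m1] near [c] and [g > m2] near [d]. *)
pose m1 := (g c *+ 2 + g d) / 3; pose m2 := (g c + g d *+ 2) / 3.
have m12 : m1 < m2 by rewrite /m1 /m2; lra.
have [|c' [h1 [h10 ac cb gm1]]] := @interior_interval g c m1 cg cI.
  by rewrite /m1; lra.
have cgN : {within I, continuous (fun t => - g t)}.
  by move=> t; apply: cvgN; exact: cg.
have [|d' [h2 [h20 ad db gm2]]] := @interior_interval _ d (- m2) cgN dI.
  by rewrite /m2; lra.
(* A common width gives both hats the same mass. *)
pose h := Num.min h1 h2.
have h0 : 0 < h by rewrite lt_min h10.
have hh1 : h <= h1 by rewrite ge_min lexx.
have hh2 : h <= h2 by rewrite ge_min lexx orbT.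
have [||||tf tf'] := @test_function_step h c' d' h0; [lra|lra|lra|lra|].
have bt e : bounded_measurable I (fun t => tent h (t - e)).
  exact/continuous_bounded_measurable/continuous_subspaceT/continuous_tent.
have itg e := integrable_bounded_measurableM (bt e) cI'.
have := g0 _ tf; rewrite tf'.
under eq_Rintegral do rewrite mulrBl.
rewrite RintegralB; [|exact: measurable_itv|exact: itg|exact: itg].
have : \int[mu]_(t in I) (tent h (t - c') * g t) <= h ^+ 2 *+ 4 * m1.
  rewrite -(@integral_tent h c'); [|lra|lra|lra].
  rewrite -RintegralZr//; apply: le_Rintegral; [exact: measurable_itv|exact: itg| |].
    suff : mu.-integrable I ((EFin \o (fun t => tent h (t - c'))) \* cst m1%:E)%E by [].
    exact: integrableZr.
  move=> t It; have [ht|ht] := leP h `|t - c'|; first by rewrite tent_out ?mul0r// ltW.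
  by apply: ler_wpM2l (tent_ge0 _ _) _ _ _; apply/ltW/gm1; lra.
have : h ^+ 2 *+ 4 * m2 <= \int[mu]_(t in I) (tent h (t - d') * g t).
  rewrite -(@integral_tent h d'); [|lra|lra|lra].
  rewrite -RintegralZr//; apply: le_Rintegral; [exact: measurable_itv| |exact: itg|].
    suff : mu.-integrable I ((EFin \o (fun t => tent h (t - d'))) \* cst m2%:E)%E by [].
    exact: integrableZr.
  move=> t It; have [ht|ht] := leP h `|t - d'|; first by rewrite tent_out ?mul0r// ltW.
  apply: ler_wpM2l (tent_ge0 _ _) _ _ _.
  by apply: ltW; rewrite -ltrN2; apply: gm2; lra.
have h20' : 0 < h ^+ 2 by rewrite exprn_gt0.
have : h ^+ 2 *+ 4 * m1 < h ^+ 2 *+ 4 * m2 by rewrite ltr_pM2l// pmulrn_lgt0.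
lra.
Qed.

Lemma Rintegral_indicator (c d : R) (f : R -> R) : a <= c -> d <= b ->
  \int[mu]_(t in `[c, d]) f t =
  \int[mu]_(t in I) ((c <= t)%R%:R * (t <= d)%R%:R * f t).
Proof.
move=> ac db; rewrite Rintegral_mkcond [RHS]Rintegral_mkcond.
apply: eq_Rintegral => t _; rewrite !patchE !mem_setE !in_itv/=.
case: (leP c t) => ct; case: (leP t d) => td /=;
  rewrite ?mul0r ?mulr0 ?mul1r ?mul0r ?if_same//.
by rewrite (le_trans ac ct) (le_trans td db).
Qed.

(** The primitive [V] of [v] has weak derivative [v], so [w - V] has weak derivative zero and is
    constant. Integration by parts for [V] is Fubini's theorem applied to [phi t], written as minus
    the integral of [phi'] over [t, b]. *)
Lemma weak_derivative_integral (w v : R -> R) : {within I, continuous w} ->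
  mu.-integrable I (EFin \o v) ->
  (forall phi, test_function a b phi ->
    \int[mu]_(t in I) (derive1 phi t * w t) = - \int[mu]_(t in I) (phi t * v t)) ->
  forall t, t \in `[a, b] ->
    w t = w a + \int[mu]_(s in I) ((s <= t)%R%:R * v s).
Proof.
move=> cw iv wv.
pose V t := \int[mu]_(s in `[a, t]) v s.
have VE t : t \in `[a, b] -> V t = \int[mu]_(s in I) ((s <= t)%R%:R * v s).
  rewrite in_itv/= => /andP[at_ tb]; rewrite /V Rintegral_indicator//.
  apply: eq_Rintegral => s; rewrite mem_setE in_itv/= => /andP[-> _].
  by rewrite mul1r.
have cV : {within I, continuous V}.
  exact: parameterized_integral_continuous (ltW hab) iv.
have iV : mu.-integrable I (EFin \o V).
  exact: continuous_compact_integrable (@segment_compact _ _ _) cV.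
have iw : mu.-integrable I (EFin \o w).
  exact: continuous_compact_integrable (@segment_compact _ _ _) cw.
pose g t := w t - V t.
have cg : {within I, continuous g} by move=> t; apply: cvgB; [exact: cw|exact: cV].
have g0 phi : test_function a b phi ->
    \int[mu]_(t in I) (derive1 phi t * g t) = 0.
  move=> tphi; have [dphi cphi' _ sphi] := tphi.
  have bphi' : bounded_measurable I (derive1 phi).
    exact/continuous_bounded_measurable/continuous_subspaceT.
  (* The support lies in the open interval, hence misses [b]. *)
  have phib : phi b = 0.
    apply/eqP/negPn/negP => phib.
    by have /sphi := @subset_closure _ [set t | phi t != 0] b phib;
      rewrite /= in_itv/= ltxx andbF.
  have phiE t : t \in `[a, b] ->
      phi t = - \int[mu]_(s in I) ((t <= s)%R%:R * derive1 phi s).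
    rewrite in_itv/= => /andP[at_ tb].
    transitivity (- \int[mu]_(s in `[t, b]) derive1 phi s).
      by rewrite Rintegral_derive1// phib sub0r opprK.
    rewrite Rintegral_indicator//; congr (- _); apply: eq_Rintegral => s.
    by rewrite mem_setE in_itv/= => /andP[_ ->]; rewrite mulr1.
  rewrite /g; under eq_Rintegral do rewrite mulrBr.
  rewrite RintegralB//;
    [|exact: integrable_bounded_measurableM|exact: integrable_bounded_measurableM].
  rewrite (wv _ tphi).
  have -> : \int[mu]_(t in I) (phi t * v t) = \int[mu]_(t in I)
      ((\int[mu]_(s in I) ((t <= s)%R%:R * - derive1 phi s)) * v t).
    apply: eq_Rintegral => t; rewrite mem_setE => tI; rewrite phiE//; congr (_ * _).
    under [RHS]eq_Rintegral do rewrite mulrN -mulN1r.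
    rewrite RintegralZl ?mulN1r//; apply: integrable_bounded_measurableM.
      by apply: bounded_measurable_le => //; exact: measurable_cst.
    exact: bounded_measurable_integrable.
  rewrite -(@Fubini_Rintegral _ a b (fun z => (z.2 <= z.1)%R%:R * - derive1 phi
    z.1))//=; last first.
    apply: bounded_measurableM.
      by apply: bounded_measurable_le; apply: measurable_funTS;
        [exact: measurable_snd|exact: measurable_fst].
    have mII : measurable (I `*` I) by exact: measurableX.
    apply: (bounded_measurable_comp (E := I) (f := fun s => - derive1 phi s) (g :=
      fst)) => //; first by move=> [s t] [].
    apply: eq_bounded_measurable
      (bounded_measurableM (bounded_measurable_cst I (-1)) bphi') => t _.
    by rewrite mulN1r.
  have -> : \int[mu]_(s in I) \int[mu]_(t in I)
      ((t <= s)%R%:R * - derive1 phi s * v t) =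
      \int[mu]_(s in I) (-1 * (derive1 phi s * V s)).
    apply: eq_Rintegral => s; rewrite mem_setE => sI; rewrite VE// mulN1r -mulNr.
    rewrite -RintegralZl//; last first.
      apply: integrable_bounded_measurableM => //.
      by apply: bounded_measurable_le => //; exact: measurable_cst.
    by apply: eq_Rintegral => t _; rewrite mulrA [- _ * _]mulrC.
  rewrite RintegralZl//; last exact: integrable_bounded_measurableM.
  by rewrite mulN1r opprK subrr.
move=> t tI; have aI : a \in `[a, b] by rewrite in_itv/= lexx ltW.
have : g t = g a.
  by apply/eqP; rewrite eq_le !(zero_weak_derivative_le cg g0).
by rewrite /g {2}/V set_itv1 Rintegral_set1 subr0 -VE// => <-; rewrite subrK.
Qed.

End DuBoisReymond.

(** * Integrals of matrices *)

Section MatrixIntegrals.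
Context {R : realType} (a b : R) (hab : a < b).
Local Notation mu := (@lebesgue_measure R).
Local Notation I := (`[a, b]%classic : set R).

Definition bounded_measurable_mx {d} {T : measurableType d} (D : set T) p q
  (F : T -> 'M[R]_(p, q)) : Prop :=
  forall i j, bounded_measurable D (fun t => F t i j).

Definition integrable_mx p q (F : R -> 'M[R]_(p, q)) : Prop :=
  forall i j, mu.-integrable I (EFin \o (fun t => F t i j)).

Section Closure.
Context {d : measure_display} {T : measurableType d} (D : set T).

Lemma bounded_measurable_mx_cst p q (A : 'M[R]_(p, q)) :
  bounded_measurable_mx D (fun=> A).
Proof. by move=> i j; exact: bounded_measurable_cst. Qed.

Lemma bounded_measurable_mxD p q (F G : T -> 'M[R]_(p, q)) :
  bounded_measurable_mx D F -> bounded_measurable_mx D G ->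
  bounded_measurable_mx D (fun t => F t + G t).
Proof.
move=> bF bG i j.
by apply: eq_bounded_measurable (bounded_measurableD (bF i j) (bG i j)) => t _; rewrite mxE.
Qed.

Lemma bounded_measurable_mxM p q r (F : T -> 'M[R]_(p, q)) (G : T -> 'M[R]_(q, r)) :
  bounded_measurable_mx D F -> bounded_measurable_mx D G ->
  bounded_measurable_mx D (fun t => F t *m G t).
Proof.
move=> bF bG i j.
apply: eq_bounded_measurable (bounded_measurable_sum (index_enum _)
  (fun k => bounded_measurableM (bF i k) (bG k j))) => t _.
by rewrite mxE.
Qed.

Lemma bounded_measurable_mxZ p q (f : T -> R) (F : T -> 'M[R]_(p, q)) :
  bounded_measurable D f -> bounded_measurable_mx D F ->
  bounded_measurable_mx D (fun t => f t *: F t).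
Proof.
move=> bf bF i j.
by apply: eq_bounded_measurable (bounded_measurableM bf (bF i j)) => t _; rewrite mxE.
Qed.

Lemma bounded_measurable_trmx p q (F : T -> 'M[R]_(p, q)) :
  bounded_measurable_mx D F -> bounded_measurable_mx D (fun t => (F t)^T).
Proof.
by move=> bF i j; apply: eq_bounded_measurable (bF j i) => t _; rewrite mxE.
Qed.

(** A variable with values in [a, b]: a projection of a power of [a, b] or a constant. Kernels
    defined on [a, b] or its square are evaluated at such variables. *)
Definition coordinate (g : T -> R) : Prop :=
  measurable_fun [set: T] g /\ forall z, D z -> I (g z).

Lemma coordinate_cst (s : R) : s \in `[a, b] -> coordinate (fun=> s).
Proof. by move=> sI; split; [exact: measurable_cst|]. Qed.

Lemma bounded_measurable_coordinate (g : T -> R) : coordinate g -> bounded_measurable D g.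
Proof.
move=> [mg gI]; split; first exact: measurable_funTS.
exists (`|a| + `|b|) => z /gI; rewrite /= in_itv/= => /andP[ag gb].
have := ler_norm b; have := ler_norm (- a); rewrite normrN ler_norml.
by have := normr_ge0 a; have := normr_ge0 b => *; apply/andP; split; lra.
Qed.

Lemma bounded_measurable_coordinateB (g h : T -> R) : coordinate g -> coordinate h ->
  bounded_measurable D (fun z => g z - h z).
Proof.
move=> /bounded_measurable_coordinate cg /bounded_measurable_coordinate ch.
apply: eq_bounded_measurable (bounded_measurableD cg
  (bounded_measurableM (bounded_measurable_cst D (-1)) ch)) => z _.
by rewrite mulN1r.
Qed.

Lemma bounded_measurable_coordinate_le (g h : T -> R) : coordinate g -> coordinate h ->
  bounded_measurable D (fun z => (g z <= h z)%R%:R : R).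
Proof.
by move=> [mg _] [mh _]; apply: bounded_measurable_le; exact: measurable_funTS.
Qed.

Lemma bounded_measurable_mx_comp p q (F : R -> 'M[R]_(p, q)) (g : T -> R) :
  measurable D -> bounded_measurable_mx I F -> coordinate g ->
  bounded_measurable_mx D (fun z => F (g z)).
Proof.
move=> mD bF [mg gI] i j.
by apply: (bounded_measurable_comp (E := I) (f := fun t => F t i j) (g := g)) => //;
  exact: bF.
Qed.

Lemma bounded_measurable_mx_comp2 p q (K : R -> R -> 'M[R]_(p, q)) (g h : T -> R) :
  measurable D -> bounded_measurable_mx (I `*` I) (fun z => K z.1 z.2) ->
  coordinate g -> coordinate h ->
  bounded_measurable_mx D (fun z => K (g z) (h z)).
Proof.
move=> mD bK [mg gI] [mh hI] i j.
apply: (bounded_measurable_comp (E := I `*` I) (f := fun z => K z.1 z.2 i j)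
  (g := fun z => (g z, h z))) => //.
- exact: measurableX.
- exact: measurable_fun_pair.
- by move=> z Dz; split; [exact: gI|exact: hI].
Qed.

End Closure.

Lemma coordinate_id : coordinate I (fun s => s).
Proof. by split; [exact: measurable_id|]. Qed.

Lemma coordinate1 : coordinate (I `*` I) fst.
Proof. by split; [exact: measurable_fst|move=> z []]. Qed.

Lemma coordinate2 : coordinate (I `*` I) snd.
Proof. by split; [exact: measurable_snd|move=> z []]. Qed.

Lemma coordinate11 : coordinate (I `*` I `*` I) (fun z => z.1.1).
Proof.
split; last by move=> z [[]].
exact: measurableT_comp measurable_fst measurable_fst.
Qed.

Lemma coordinate12 : coordinate (I `*` I `*` I) (fun z => z.1.2).
Proof.
split; last by move=> z [[]].
exact: measurableT_comp measurable_snd measurable_fst.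
Qed.

Lemma coordinate3 : coordinate (I `*` I `*` I) snd.
Proof. by split; [exact: measurable_snd|move=> z []]. Qed.

Lemma bounded_measurable_integrable_mx p q (F : R -> 'M[R]_(p, q)) :
  bounded_measurable_mx I F -> integrable_mx F.
Proof. by move=> bF i j; exact: bounded_measurable_integrable. Qed.

(** Both claims go through one induction, since additivity needs the tail of the sum to be
    integrable. *)
Lemma Rintegral_sum (J : finType) (F : J -> R -> R) :
  (forall k, mu.-integrable I (EFin \o F k)) ->
  mu.-integrable I (EFin \o (fun t => \sum_k F k t)) /\
  \int[mu]_(t in I) (\sum_k F k t) = \sum_k \int[mu]_(t in I) F k t.
Proof.
move=> iF; elim: (index_enum J) => [|k r [ir IH]].
  have -> : (fun t => \sum_(k <- [::]) F k t) = fun=> 0.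
    by apply/funext => t; rewrite big_nil.
  rewrite big_nil; split.
    by apply: bounded_measurable_integrable; exact: bounded_measurable_cst.
  by rewrite Rintegral_cst// mul0r.
have -> : (fun t => \sum_(j <- k :: r) F j t) =
    fun t => F k t + \sum_(j <- r) F j t.
  by apply/funext => t; rewrite big_cons.
rewrite big_cons; split.
  suff : mu.-integrable I ((EFin \o F k) \+ (EFin \o (fun t => \sum_(j <- r) F j
    t)%R))%E by [].
  by apply: integrableD.
by rewrite RintegralD// IH.
Qed.

Lemma integrable_mxM p q r (K : R -> 'M[R]_(p, q)) (u : R -> 'M[R]_(q, r)) :
  bounded_measurable_mx I K -> integrable_mx u -> integrable_mx (fun t => K t *m u t).
Proof.
move=> bK iu i j.
have -> : EFin \o (fun t => (K t *m u t) i j) =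
    EFin \o (fun t => \sum_k K t i k * u t k j).
  by apply/funext => t /=; rewrite mxE.
apply: (Rintegral_sum _).1 => k; exact: integrable_bounded_measurableM.
Qed.

Lemma mxintE p q (F : R -> 'M[R]_(p, q)) (c d : R) i j : c <= d ->
  mxint c d F i j = \int[mu]_(t in `[c, d]) F t i j.
Proof. by rewrite /mxint => ->; rewrite mxE. Qed.

Lemma eq_mxint p q (F G : R -> 'M[R]_(p, q)) (c d : R) : c <= d ->
  (forall t, t \in `[c, d] -> F t = G t) -> mxint c d F = mxint c d G.
Proof.
move=> cd FG; apply/matrixP => i j; rewrite !mxintE//.
by apply: eq_Rintegral => t; rewrite mem_setE => /FG ->.
Qed.

Local Notation J := (mxint a b).
Let ab := ltW hab.

Lemma mxintD p q (F G : R -> 'M[R]_(p, q)) : integrable_mx F -> integrable_mx G ->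
  J (fun t => F t + G t) = J F + J G.
Proof.
move=> iF iG; apply/matrixP => i j; rewrite mxE !mxintE//.
by under eq_Rintegral do rewrite mxE; rewrite RintegralD.
Qed.

Lemma mxintMl p q r (A : 'M[R]_(p, q)) (F : R -> 'M[R]_(q, r)) :
  integrable_mx F -> J (fun t => A *m F t) = A *m J F.
Proof.
move=> iF; apply/matrixP => i j; rewrite mxE mxintE//.
under eq_Rintegral do rewrite mxE.
rewrite (Rintegral_sum _).2 => [|k]; last first.
  by apply: integrable_bounded_measurableM => //; exact: bounded_measurable_cst.
by apply: eq_bigr => k _; rewrite mxintE// RintegralZl.
Qed.

Lemma trmx_mxint p q (F : R -> 'M[R]_(p, q)) : (J F)^T = J (fun t => (F t)^T).
Proof.
apply/matrixP => i j; rewrite mxE !mxintE//.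
by apply: eq_Rintegral => t _; rewrite mxE.
Qed.

Lemma mxintMr p q r (F : R -> 'M[R]_(p, q)) (A : 'M[R]_(q, r)) :
  integrable_mx F -> J (fun t => F t *m A) = J F *m A.
Proof.
move=> iF; rewrite -[RHS]trmxK trmx_mul trmx_mxint -mxintMl.
  by rewrite trmx_mxint; apply: eq_mxint => // t _; rewrite trmx_mul !trmxK.
by move=> i j; have := iF j i; congr integrable; apply/funext => t /=; rewrite mxE.
Qed.

Lemma bounded_measurable_mxint {d} {T : measurableType d} (D : set T) p q r
    (K : T * R -> 'M[R]_(p, q)) (u : R -> 'M[R]_(q, r)) : measurable D ->
  bounded_measurable_mx (D `*` I) K -> integrable_mx u ->
  bounded_measurable_mx D (fun z => J (fun t => K (z, t) *m u t)).
Proof.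
move=> mD bK iu i j.
have := bounded_measurable_sum (index_enum _)
  (fun k => bounded_measurable_integral mD (bK i k) (iu k j)).
apply: eq_bounded_measurable => z; rewrite inE => Dz; rewrite mxintE//.
under [RHS]eq_Rintegral do rewrite mxE.
have bKz k : bounded_measurable I (fun t => K (z, t) i k).
  apply: (bounded_measurable_comp (E := D `*` I) (f := fun z => K z i k)
    (g := fun t => (z, t))) => //; [exact: measurableX|exact: pair1_measurable].
rewrite (Rintegral_sum _).2// => k.
by apply: integrable_bounded_measurableM; [exact: bKz|exact: iu].
Qed.

(** With the identity in place of [u], facts about [K *m u] become facts about [K] alone. *)
Lemma integrable_mx1 p : integrable_mx (fun=> 1%:M : 'M[R]_p).
Proof. exact/bounded_measurable_integrable_mx/bounded_measurable_mx_cst. Qed.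

Lemma bounded_measurable_mxint1 {d} {T : measurableType d} (D : set T) p q
    (K : T -> R -> 'M[R]_(p, q)) : measurable D ->
  bounded_measurable_mx (D `*` I) (fun z => K z.1 z.2) ->
  bounded_measurable_mx D (fun z => J (K z)).
Proof.
move=> mD bK i j.
apply: eq_bounded_measurable (bounded_measurable_mxint mD bK (@integrable_mx1 q) i j)
  => z _.
by congr (fun_of_matrix _ i j); apply: eq_mxint => // t _; rewrite mulmx1.
Qed.

(** Each entry is a finite sum of scalar exchanges; [u] does not depend on [s], so it leaves the
    inner integral. *)
Lemma mxint_Fubini p q r (K : R -> R -> 'M[R]_(p, q)) (u : R -> 'M[R]_(q, r)) :
  bounded_measurable_mx (I `*` I) (fun z => K z.1 z.2) -> integrable_mx u ->
  J (fun s => J (fun t => K s t *m u t)) = J (fun t => J (K^~ t) *m u t).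
Proof.
move=> bK iu; apply/matrixP => i j; rewrite !mxintE//.
have bs s k : s \in `[a, b] -> bounded_measurable I (fun t => K s t i k).
  move=> sI; have mI : measurable I by exact: measurable_itv.
  apply: (bounded_measurable_mx_comp2 (g := fun=> s) (h := fun t => t) mI bK).
    exact: coordinate_cst.
  exact: coordinate_id.
transitivity (\sum_k \int[mu]_(s in I) \int[mu]_(t in I) (K s t i k * u t k j)).
  rewrite -(Rintegral_sum _).2 => [|k]; last first.
    apply: bounded_measurable_integrable.
    by apply: (bounded_measurable_integral _ (bK i k)) => //; exact: iu.
  apply: eq_Rintegral => s; rewrite mem_setE => sI; rewrite mxintE//.
  under eq_Rintegral do rewrite mxE.
  rewrite (Rintegral_sum _).2// => k.
  by apply: integrable_bounded_measurableM; [exact: bs|exact: iu].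
under [RHS]eq_Rintegral do rewrite mxE.
rewrite (Rintegral_sum _).2 => [|k]; last first.
  apply: integrable_bounded_measurableM; last exact: iu.
  have mI : measurable I by exact: measurable_itv.
  apply: (bounded_measurable_mxint1 (K := fun t s => K s t) mI).
  apply: (bounded_measurable_mx_comp2 (g := snd) (h := fst) _ bK);
    [exact: measurableX| |].
    exact: coordinate2.
  exact: coordinate1.
apply: eq_bigr => k _; rewrite (Fubini_Rintegral (bK i k) (iu k j)).
by apply: eq_Rintegral => t _; rewrite mxintE.
Qed.

Lemma mxint_Fubini1 p q (K : R -> R -> 'M[R]_(p, q)) :
  bounded_measurable_mx (I `*` I) (fun z => K z.1 z.2) ->
  J (fun s => J (K s)) = J (fun t => J (K^~ t)).
Proof.
move=> bK; have := mxint_Fubini bK (@integrable_mx1 q).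
move=> H; transitivity (J (fun s => J (fun t => K s t *m 1%:M))).
  by apply: eq_mxint => // s _; apply: eq_mxint => // t _; rewrite mulmx1.
by rewrite H; apply: eq_mxint => // t _; rewrite mulmx1.
Qed.

Lemma mxint_indicator p q (F : R -> 'M[R]_(p, q)) (c d : R) : a <= c -> c <= d -> d <= b ->
  mxint c d F = J (fun t => (c <= t)%R%:R *: ((t <= d)%R%:R *: F t)).
Proof.
move=> ac cd db; apply/matrixP => i j; rewrite !mxintE// (Rintegral_indicator _ ac db).
by apply: eq_Rintegral => t _; rewrite !mxE mulrA.
Qed.

Lemma mxint_indicatorl p q (F : R -> 'M[R]_(p, q)) (s : R) : s \in `[a, b] ->
  mxint a s F = J (fun t => (t <= s)%R%:R *: F t).
Proof.
rewrite in_itv/= => /andP[as_ sb]; rewrite mxint_indicator//.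
by apply: eq_mxint => // t; rewrite in_itv/= => /andP[-> _]; rewrite scale1r.
Qed.

Lemma mxint_indicatorr p q (F : R -> 'M[R]_(p, q)) (s : R) : s \in `[a, b] ->
  mxint s b F = J (fun t => (s <= t)%R%:R *: F t).
Proof.
rewrite in_itv/= => /andP[as_ sb]; rewrite mxint_indicator//.
by apply: eq_mxint => // t; rewrite in_itv/= => /andP[_ ->]; rewrite scale1r.
Qed.

Lemma mxint_chasles p q (F : R -> 'M[R]_(p, q)) (s : R) : s \in `[a, b] ->
  integrable_mx F -> mxint a s F + mxint s b F = J F.
Proof.
rewrite in_itv/= => /andP[as_ sb] iF; apply/matrixP => i j; rewrite mxE !mxintE//.
have := @Rintegral_itvB R (fun t => F t i j) (BLeft a) (BRight b) s (iF i j).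
rewrite !bnd_simp => /(_ as_ sb) => H.
(* The two closed intervals share [s], a null set. *)
rewrite -(@Rintegral_itv_obnd_cbnd _ s (BRight b)); first by rewrite -H addrC subrK.
apply: integrableS (iF i j) => //.
by apply: subset_itvr; rewrite bnd_simp.
Qed.

End MatrixIntegrals.

(** * Kernels *)

Section PIKernels.
Context {R : realType} (n : nat) (a b : R) (hab : a < b).
Context (B : 'M[R]_(n + n, n + (n + (n + n)))).
Context (M : R -> 'M[R]_n) (N1 N2 : R -> R -> 'M[R]_n).
Context (hM : bounded_measurable1 a b M).
Context (hN1 : bounded_measurable2 a b N1) (hN2 : bounded_measurable2 a b N2).

Local Notation I := (`[a, b]%classic : set R).
Local Notation J := (mxint a b).
Local Notation ind s t := ((s <= t)%R%:R : R).
Local Notation Ba := (Ba a b B).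
Local Notation Bb := (Bb a b B).
Local Notation Y1 := (Y1 a b B M N1 N2).
Local Notation Y2 := (Y2 a b M N1 N2).
Local Notation F4 := (F4 M N1).
Local Notation F5 := (F5 N2).

Let ab : a <= b := ltW hab.
Let bI : b \in `[a, b]. Proof. by rewrite in_itv/= lexx andbT. Qed.

(** The affine dependence on [s] is made visible; with [B5E] it yields the bounded measurability of
    [Ba]. *)
Lemma B4E s : B4 a b B s =
  lsubmx (usubmx (B3 a b B)) + (s - a) *: lsubmx (dsubmx (B3 a b B)).
Proof.
rewrite /B4 -[in LHS](vsubmxK (B3 a b B)) mul_row_col mul1mx mul_scalar_mx.
by rewrite linearD linearZ.
Qed.

Lemma B5E s : B5 a b B s =
  rsubmx (usubmx (B3 a b B)) + (s - a) *: rsubmx (dsubmx (B3 a b B)).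
Proof.
rewrite /B5 -[in LHS](vsubmxK (B3 a b B)) mul_row_col mul1mx mul_scalar_mx.
by rewrite linearD linearZ.
Qed.

(* In terms of u = x_ss: [xk], [xsk] and [Lk] are the kernels of x, x_s and P x_s;
   [Nk] is the integral part of P, and [Gk] the part of [Lk] without [Bb]. *)
Definition xsk (s e : R) : 'M[R]_n := ind e s *: 1%:M + Bb e.
Definition xk (s e : R) : 'M[R]_n := ((ind e s) * (s - e)) *: 1%:M + Ba s e.
Definition Nk (s t : R) : 'M[R]_n :=
  ind t s *: N1 s t + ind s t *: N2 s t.
Definition Gk (s e : R) : 'M[R]_n :=
  ind e s *: M s + J (fun t => ind e t *: Nk s t).
Definition Lk (s e : R) : 'M[R]_n := Y2 s *m Bb e + Gk s e.

Let mI : measurable I. Proof. exact: measurable_itv. Qed.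
Let mII : measurable (I `*` I). Proof. exact: measurableX. Qed.
Let mIII : measurable (I `*` I `*` I). Proof. exact: measurableX. Qed.

Lemma bounded_measurable_mx_of1 : bounded_measurable_mx I M.
Proof.
have [mM [C MC]] := hM; move=> i j; split; first exact: mM.
by exists C => t tI; exact: MC.
Qed.

Lemma bounded_measurable_mx_of2 (N : R -> R -> 'M[R]_n) : bounded_measurable2 a b N ->
  bounded_measurable_mx (I `*` I) (fun z => N z.1 z.2).
Proof.
move=> [mN [C NC]] i j; split; first exact: mN.
by exists C => -[s t] [sI tI]; exact: NC.
Qed.

Let bM := bounded_measurable_mx_of1.
Let bN1 := bounded_measurable_mx_of2 hN1.
Let bN2 := bounded_measurable_mx_of2 hN2.

(** Bounded measurability is read off the shape of a kernel: sums, products, transposes, 0-1 factors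
    and differences of coordinates. [bm1] and [bm2] add known functions of one or two variables
    evaluated at coordinates. *)
Ltac bm_step := lazymatch goal with
  | |- coordinate _ _ _ _ => first
    [ exact: coordinate_id | exact: coordinate1 | exact: coordinate2
    | exact: coordinate11 | exact: coordinate12 | exact: coordinate3
    | by refine (coordinate_cst _ _); assumption ]
  | |- bounded_measurable_mx _ _ => first
    [ apply: bounded_measurable_mx_cst
    | apply: bounded_measurable_mxZ
    | apply: bounded_measurable_mxM
    | apply: bounded_measurable_mxD
    | apply: bounded_measurable_trmx ]
  | |- bounded_measurable _ _ => first
    [ apply: bounded_measurable_cst
    | apply: bounded_measurable_coordinate_le
    | apply: bounded_measurable_coordinateB
    | apply: bounded_measurableM ]
  | |- _ => first [ exact: mI | exact: mII | exact: mIII ]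
  end.

Ltac bm1 F h := lazymatch goal with
  | |- bounded_measurable_mx _ (fun z => F (@?g z)) =>
    refine (@bounded_measurable_mx_comp R a b _ _ _ _ _ F g _ h _)
  | |- bounded_measurable_mx _ F => exact: h end.
Ltac bm2 K h := lazymatch goal with
  | |- bounded_measurable_mx _ (fun z => K (@?g z) (@?k z)) =>
    refine (@bounded_measurable_mx_comp2 R a b _ _ _ _ _ K g k _ h _ _)
  | |- bounded_measurable_mx _ (K ?s) =>
    refine (@bounded_measurable_mx_comp2 R a b _ _ _ _ _ K (fun=> s) id _ h _ _) end.

Lemma bounded_measurable_Bb : bounded_measurable_mx I Bb.
Proof. by rewrite /Bb; repeat bm_step. Qed.

Lemma bounded_measurable_Ba : bounded_measurable_mx (I `*` I) (fun z => Ba z.1 z.2).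
Proof.
have aI : a \in `[a, b] by rewrite in_itv/= lexx.
have -> : (fun z => Ba z.1 z.2) = (fun z : R * R =>
   (b - z.2) *: (lsubmx (usubmx (B3 a b B)) + (z.1 - a) *: lsubmx (dsubmx (B3 a b B))) +
   (rsubmx (usubmx (B3 a b B)) + (z.1 - a) *: rsubmx (dsubmx (B3 a b B)))).
  by apply/funext => z; rewrite /Ba B4E B5E.
by repeat bm_step.
Qed.

Let bBa := bounded_measurable_Ba.
Let bBb := bounded_measurable_Bb.

Lemma bounded_measurable_Nk : bounded_measurable_mx (I `*` I) (fun z => Nk z.1 z.2).
Proof. by rewrite /Nk; repeat first [bm2 N1 bN1 | bm2 N2 bN2 | bm_step]. Qed.

Let bNk := bounded_measurable_Nk.

Lemma bounded_measurable_xk : bounded_measurable_mx (I `*` I) (fun z => xk z.1 z.2).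
Proof. by rewrite /xk; repeat first [bm2 constr:(Ba) bBa | bm_step]. Qed.

Lemma bounded_measurable_xsk : bounded_measurable_mx (I `*` I) (fun z => xsk z.1 z.2).
Proof. by rewrite /xsk; repeat first [bm1 constr:(Bb) bBb | bm_step]. Qed.

(** [Y2] is P applied to the constant identity matrix. This is why it multiplies [Bb e], the part of
    [xsk t e] that is constant in [t]. *)
Lemma Y2E s : s \in `[a, b] -> Y2 s = M s + J (Nk s).
Proof.
move=> sI; rewrite /Defs.Y2 (mxint_indicatorl hab _ sI) (mxint_indicatorr hab _ sI)
  -addrA; congr (_ + _).
rewrite -mxintD//; try apply: bounded_measurable_integrable_mx;
  by do 2 repeat first [bm2 N1 bN1 | bm2 N2 bN2 | bm_step].
Qed.

Lemma bounded_measurable_Gk : bounded_measurable_mx (I `*` I) (fun z => Gk z.1 z.2).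
Proof.
rewrite /Gk; apply: bounded_measurable_mxD; first by repeat first [bm1 M bM | bm_step].
apply: (bounded_measurable_mxint1 hab
  (K := fun (z : R * R) t => (ind z.2 t) *: Nk z.1 t) mII).
by repeat first [bm2 Nk bNk | bm_step].
Qed.

Let bGk := bounded_measurable_Gk.

Let bY2' : bounded_measurable_mx I (fun s => M s + J (Nk s)).
Proof.
apply: bounded_measurable_mxD => //.
exact: (bounded_measurable_mxint1 hab (K := Nk) mI).
Qed.

Lemma bounded_measurable_Y2 : bounded_measurable_mx I Y2.
Proof.
move=> i j; apply: eq_bounded_measurable (bY2' i j) => s; rewrite inE => sI.
by rewrite Y2E.
Qed.

Let bY2 := bounded_measurable_Y2.

Lemma bounded_measurable_Lk : bounded_measurable_mx (I `*` I) (fun z => Lk z.1 z.2).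
Proof. by rewrite /Lk;
  repeat first [bm1 constr:(Y2) bY2 | bm1 constr:(Bb) bBb | bm2 Gk bGk | bm_step]. Qed.

Let bLk := bounded_measurable_Lk.
Let bxk := bounded_measurable_xk.
Let bxsk := bounded_measurable_xsk.

Ltac bm := do 2 repeat first
  [ bm2 N1 bN1 | bm2 N2 bN2 | bm2 Nk bNk | bm2 Gk bGk | bm2 Lk bLk | bm2 xk bxk | bm2
    xsk bxsk | bm2 constr:(Ba) bBa
  | bm1 M bM | bm1 constr:(Y2) bY2 | bm1 constr:(Bb) bBb | bm_step ].
Ltac ibm := apply: bounded_measurable_integrable_mx; bm.

Lemma mxintZ p q (c : R) (F : R -> 'M[R]_(p, q)) : integrable_mx a b F ->
  J (fun t => c *: F t) = c *: J F.
Proof.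
move=> iF; rewrite -mul_scalar_mx -mxintMl//; apply: eq_mxint => // t _.
by rewrite mul_scalar_mx.
Qed.

(** * The operator and the inner product in terms of kernels *)

Section Operators.
Context (u : R -> 'cV[R]_n) (iu : integrable_mx a b u).

(** After the exchange of integrals, the constant part of [xsk] produces [Y2 s *m Bb e] and its
    indicator part produces [Gk s e]. *)
Lemma pi_op_kernel (xs : R -> 'cV[R]_n) (s : R) : s \in `[a, b] ->
  (forall t, t \in `[a, b] -> xs t = J (fun e => xsk t e *m u e)) ->
  pi_op a b M N1 N2 xs s = J (fun e => Lk s e *m u e).
Proof.
move=> sI xsE; rewrite /pi_op (mxint_indicatorl hab _ sI) (mxint_indicatorr hab _ sI).
have bxs : bounded_measurable_mx I xs.
  move=> i j.
  apply: eq_bounded_measurable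
    (bounded_measurable_mxint hab mI bxsk iu i j) => t.
  by rewrite inE => tI; rewrite xsE.
have -> : M s *m xs s + J (fun t => ind t s *: (N1 s t *m xs t)) +
    J (fun t => ind s t *: (N2 s t *m xs t)) =
    M s *m xs s + J (fun t => Nk s t *m xs t).
  rewrite -addrA; congr (_ + _); rewrite -mxintD//; [|ibm; bm1 xs bxs; bm|ibm;
    bm1 xs bxs; bm].
  by apply: eq_mxint => // t _; rewrite mulmxDl -!scalemxAl.
rewrite xsE// -(mxintMl hab); last by apply: integrable_mxM => //; bm.
have -> : J (fun t => Nk s t *m xs t) =
    J (fun e => J (fun t => Nk s t *m xsk t e) *m u e).
  rewrite -mxint_Fubini//; last by bm.
  apply: eq_mxint => // t tI; rewrite xsE// -(mxintMl hab);
    last by apply: integrable_mxM => //; bm.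
  by apply: eq_mxint => // e _; rewrite mulmxA.
rewrite -mxintD//; last 2 first.
- have -> : (fun e => M s *m (xsk s e *m u e)) = (fun e => (M s *m xsk s e) *m u e).
    by apply/funext => e; rewrite mulmxA.
  by apply: integrable_mxM => //; bm.
- apply: integrable_mxM => //.
  apply: (bounded_measurable_mxint1 hab (K := fun e t => Nk s t *m xsk t e) mI); bm.
apply: eq_mxint => // e eI; rewrite mulmxA -mulmxDl; congr (_ *m _).
have -> : J (fun t => Nk s t *m xsk t e) =
    J (Nk s) *m Bb e + J (fun t => ind e t *: Nk s t).
  rewrite -(mxintMr hab); last by ibm.
  rewrite -mxintD//; [|ibm|ibm].
  by apply: eq_mxint => // t _; rewrite mulmxDr -scalemxAr mulmx1 addrC.
rewrite /Lk Y2E// /xsk /Gk mulmxDl mulmxDr -scalemxAr mulmx1.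
by rewrite [X in X + _ = _]addrC addrACA.
Qed.

Lemma inner_L2_kernel (x y : R -> 'cV[R]_n) :
  (forall s, s \in `[a, b] -> x s = J (fun e => xk s e *m u e)) ->
  (forall s, s \in `[a, b] -> y s = J (fun e => Lk s e *m u e)) ->
  inner_L2 a b x y = inner_L2 a b u
    (fun xi => J (fun e => J (fun s => (xk s xi)^T *m Lk s e) *m u e)).
Proof.
move=> xE yE.
have by_ : bounded_measurable_mx I y.
  move=> i j.
  apply: eq_bounded_measurable (bounded_measurable_mxint hab mI bLk iu i j) => t.
  by rewrite inE => tI; rewrite yE.
(* A 1 x 1 matrix equals its transpose; in this order [u] stands to the right of the kernel once [x]
   is expanded. *)
have -> : inner_L2 a b x y = J (fun s => (y s)^T *m x s) 0 0.
  rewrite mxintE//; apply: eq_Rintegral => s _.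
  by rewrite -[in LHS](trmxK (y s)) -trmx_mul mxE.
have -> : J (fun s => (y s)^T *m x s) =
    J (fun xi => J (fun s => (y s)^T *m xk s xi) *m u xi).
  rewrite -mxint_Fubini//; last by bm; bm1 y by_; bm.
  apply: eq_mxint => // s sI; rewrite xE// -(mxintMl hab);
    last by apply: integrable_mxM => //; bm.
  by apply: eq_mxint => // xi _; rewrite mulmxA.
(* A second exchange folds the inner integral over [e] back into [y]. *)
have KE (xi : R) : xi \in `[a, b] ->
    J (fun e => J (fun s => (xk s xi)^T *m Lk s e) *m u e) =
    J (fun s => (xk s xi)^T *m y s).
  move=> xiI; rewrite -mxint_Fubini//; last by bm.
  apply: eq_mxint => // s sI; rewrite (yE _ sI) -[RHS](mxintMl hab); last first.
    by apply: integrable_mxM iu; bm.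
  by apply: eq_mxint => // e _; rewrite mulmxA.
rewrite mxintE//; apply: eq_Rintegral => xi; rewrite mem_setE => xiI; rewrite KE//.
rewrite -[in RHS](trmxK (J _)) -trmx_mul [RHS]mxE; congr ((_ *m _) 0 0).
by rewrite trmx_mxint//; apply: eq_mxint => // s _; rewrite trmx_mul trmxK.
Qed.

End Operators.

(** [Y1 xi t] is [Ba] paired with column [t] of the operator. Exchanging [s] and [t] leaves the
    outer condition [e <= t] for the integral part, and the term in [M] already has this form with
    [s] in the role of [t]. *)
Lemma mxint_Ba_Gk (xi e : R) : xi \in `[a, b] -> e \in `[a, b] ->
  J (fun s => (Ba s xi)^T *m Gk s e) = mxint e b (Y1 xi).
Proof.
move=> xiI eI; rewrite (mxint_indicatorr hab _ eI).
have Y1E t : t \in `[a, b] -> Y1 xi t =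
    (Ba t xi)^T *m M t + J (fun s => (Ba s xi)^T *m Nk s t).
  move=> tI; rewrite /Defs.Y1 (mxint_indicatorl hab _ tI) (mxint_indicatorr hab _ tI)
    -addrA.
  congr (_ + _); rewrite -mxintD//; [|ibm|ibm].
  by apply: eq_mxint => // s _; rewrite mulmxDr -!scalemxAr.
have -> : J (fun t => ind e t *: Y1 xi t) =
    J (fun t => ind e t *: ((Ba t xi)^T *m M t)) +
    J (fun t => J (fun s => ind e t *: ((Ba s xi)^T *m Nk s t))).
  rewrite -mxintD//; [|ibm|].
    apply: eq_mxint => // t tI; rewrite Y1E// scalerDr mxintZ//; ibm.
  apply: bounded_measurable_integrable_mx.
  apply: (bounded_measurable_mxint1 hab (K := fun t s => ind e t *: ((Ba s xi)^T *m Nk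
    s t)) mI); bm.
rewrite -(mxint_Fubini1 hab (K := fun s t => ind e t *: ((Ba s xi)^T *m Nk s t)));
  last by bm.
rewrite -mxintD//; [|ibm|]; last first.
  apply: bounded_measurable_integrable_mx.
  apply: (bounded_measurable_mxint1 hab (K := fun s t => ind e t *: ((Ba s xi)^T *m Nk
    s t)) mI); bm.
apply: eq_mxint => // s sI; rewrite /Gk mulmxDr -scalemxAr; congr (_ + _).
rewrite -(mxintMl hab); last by ibm.
by apply: eq_mxint => // t _; rewrite -scalemxAr.
Qed.

(** In the [N1] term [e <= t <= s], so the inner integral over [t] is already that of [F4 e s]. In
    the [N2] term [xi <= s <= t] and [e <= t], so the order is exchanged and the inner integral over
    [s] is [F5 xi t]. In both cases the outer variable starts at the larger of [xi] and [e]. *)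
Lemma mxint_shift_Gk (xi e : R) : xi \in `[a, b] -> e \in `[a, b] ->
  J (fun s => ((ind xi s) * (s - xi)) *: Gk s e) =
  mxint (Num.max xi e) b (fun t => (t - xi) *: F4 e t + F5 xi t).
Proof.
move=> xiI eI.
have mxI : Num.max xi e \in `[a, b] by case: leP.
rewrite (mxint_indicatorr hab _ mxI).
(* [H] carries [N2] and will be exchanged; [G1] collects [M] and [N1], which keep their outer
   variable. *)
pose H s t : 'M[R]_n := ((ind xi s) * (s - xi)) *: (ind e t *: (ind s t *: N2 s t)).
pose P s t : 'M[R]_n := ind e t *: (ind t s *: N1 s t).
pose G1 s : 'M[R]_n := ((ind xi s) * (s - xi)) *: (ind e s *: M s + J (P s)).
have bH : bounded_measurable_mx (I `*` I) (fun z => H z.1 z.2) by rewrite /H; bm.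
have bP : bounded_measurable_mx (I `*` I) (fun z => P z.1 z.2) by rewrite /P; bm.
have bJP : bounded_measurable_mx I (fun s => J (P s)).
  exact: (bounded_measurable_mxint1 hab (K := P) mI).
have iG1 : integrable_mx a b G1.
  apply: bounded_measurable_integrable_mx.
  by rewrite /G1; apply: bounded_measurable_mxZ; [bm|apply: bounded_measurable_mxD; [bm|]].
transitivity (J G1 + J (fun s => J (H s))).
  rewrite -mxintD//; last first.
    apply: bounded_measurable_integrable_mx.
    exact: (bounded_measurable_mxint1 hab (K := H) mI).
  apply: eq_mxint => // s sI; rewrite /G1 /H mxintZ; last by ibm.
  rewrite -scalerDr; congr (_ *: _); rewrite /Gk -addrA; congr (_ + _).
  rewrite -mxintD//; [|rewrite /P; ibm|ibm].
  by apply: eq_mxint => // t _; rewrite -scalerDr.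
rewrite (mxint_Fubini1 hab bH) -mxintD//; last first.
  apply: bounded_measurable_integrable_mx.
  by apply: (bounded_measurable_mxint1 hab (K := fun t s => H s t) mI); rewrite /H; bm.
have J0 (F : R -> 'M[R]_n) : (forall s, F s = 0) -> J F = 0.
  move=> F0; have -> : F = fun=> 0 *: 0 by apply/funext => s; rewrite F0 scale0r.
  by rewrite mxintZ ?scale0r//; ibm.
apply: eq_mxint => // t tI; rewrite ge_max /G1.
(* Outside the range [max xi e <= t] the 0-1 conditions are contradictory or the outer factor
   vanishes. *)
have [et|te] /= := leP e t; last first.
  rewrite andbF !scale0r add0r !J0 ?scaler0 ?addr0// => s.
    by rewrite /H [e <= t]leNgt te scale0r scaler0.
  rewrite /P; case: (leP e s) => es; last by rewrite scale0r.
  by rewrite [s <= t]leNgt (lt_le_trans te es) scale0r scaler0.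
have [xt|tx] /= := leP xi t; last first.
  rewrite mul0r !scale0r add0r J0// => s; rewrite /H.
  case: (leP xi s) => xs; last by rewrite mul0r scale0r.
  by rewrite [s <= t]leNgt (lt_le_trans tx xs) scale0r !scaler0.
have := xiI; rewrite in_itv/= => /andP[axi _].
have := eI; rewrite in_itv/= => /andP[ae _].
have := tI; rewrite in_itv/= => /andP[_ tb].
rewrite /Defs.F4 /Defs.F5 (mxint_indicator hab _ ae et tb) (mxint_indicator hab _ axi
  xt tb) mul1r !scale1r; congr (_ + _).
apply: eq_mxint => // s _; rewrite /H et scale1r -scalerA; congr (_ *: _).
by rewrite !scalerA mulrC.
Qed.

(** Expanding [xk] and [Lk] gives four products. The shift part of [xk] times [Gk] is the integral
    common to [F1] and [F2]; the other three are the terms of [F3]. *)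
Lemma kernel_decomposition (xi e : R) : xi \in `[a, b] -> e \in `[a, b] ->
  J (fun s => (xk s xi)^T *m Lk s e) =
  mxint (Num.max xi e) b (fun t => (t - xi) *: F4 e t + F5 xi t) +
  F3 a b B M N1 N2 xi e.
Proof.
move=> xiI eI; rewrite -mxint_shift_Gk// /F3 -mxint_Ba_Gk//.
have -> : mxint xi b (fun z => (z - xi) *: Y2 z) =
    J (fun s => ((ind xi s) * (s - xi)) *: Y2 s).
  by rewrite (mxint_indicatorr hab _ xiI); apply: eq_mxint => // s _; rewrite scalerA.
rewrite -mxintMr//; last by ibm.
rewrite -!mxintD//; try by ibm.
have xkT s : (xk s xi)^T = (ind xi s * (s - xi)) *: 1%:M + (Ba s xi)^T.
  by rewrite /xk; move: (Ba s xi) => C; apply/matrixP => i j; rewrite !mxE eq_sym.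
apply: eq_mxint => // s sI; rewrite xkT /Lk.
move: (Ba s xi)^T (Y2 s) (Gk s e) (Bb e) => C Y G D.
rewrite mulmxDl !mulmxDr -!scalemxAl !mul1mx mulmxA.
by rewrite [RHS]addrA [RHS]addrC [RHS]addrA.
Qed.

(** The integral over [a, b] is split at [xi]: the maximum of [xi] and [e] is [xi] on the left,
    which gives [Q1], and [e] on the right, which gives [Q2]. *)
Lemma pi_op_Q (u : R -> 'cV[R]_n) (xi : R) : integrable_mx a b u -> xi \in `[a, b] ->
  pi_op a b (fun=> 0) (Q1 a b B M N1 N2) (Q2 a b B M N1 N2) u xi =
  J (fun e => J (fun s => (xk s xi)^T *m Lk s e) *m u e).
Proof.
move=> iu xiI; have := xiI; rewrite in_itv/= => /andP[axi xib].
rewrite /pi_op mul0mx add0r.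
have iK : integrable_mx a b (fun e => J (fun s => (xk s xi)^T *m Lk s e) *m u e).
  apply: integrable_mxM => //.
  by apply: (bounded_measurable_mxint1 hab (K := fun e s => (xk s xi)^T *m Lk s e) mI); bm.
rewrite -(mxint_chasles hab xiI iK); congr (_ + _); apply: eq_mxint => // e;
    rewrite in_itv/= => /andP[e1 e2]; congr (_ *m _).
  rewrite (kernel_decomposition xiI); last by rewrite in_itv/= e1 (le_trans e2 xib).
  by rewrite max_l.
rewrite (kernel_decomposition xiI); last by rewrite in_itv/= e2 (le_trans axi e1).
by rewrite max_r.
Qed.

End PIKernels.

(** * Boundary conditions *)

Section BoundaryConditions.
Context {R : realType} (n : nat) (a b : R) (hab : a < b).
Local Notation mu := (@lebesgue_measure R).
Local Notation I := (`[a, b]%classic : set R).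
Local Notation J := (mxint a b).
Local Notation ind s t := ((s <= t)%R%:R : R).

(** On an interval of finite measure [|v| <= 1 + v^2] suffices, a consequence of
    [(|v| - 1)^2 >= 0]. *)
Lemma in_L2_integrable (u : R -> 'cV[R]_n) : in_L2 a b u -> integrable_mx a b u.
Proof.
move=> u2 i j; rewrite ord1; have {}u2 := u2 i.
pose f := (fun t => u t i 0) \_ I.
have mf : measurable_fun setT f by move: u2; rewrite inE => /andP[]; rewrite inE.
have if2 : mu.-integrable setT (fun t => ((`|f t| `^ 2)%:E)%E).
  by apply: Lfun_integrable u2; rewrite ler1n.
have if2I : mu.-integrable I (fun t => ((`|f t| `^ 2)%:E)%E).
  exact: integrableS if2.
have i1 : mu.-integrable I (EFin \o (fun=> 1)).
  exact/bounded_measurable_integrable/bounded_measurable_cst.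
have muI : measurable_fun I (fun t => u t i 0).
  by apply/measurable_restrictT => //; exact: measurable_itv.
apply: le_integrable (integrableD _ i1 if2I) => //.
  exact/measurable_EFinP.
move=> t tI /=; rewrite lee_fin powR_mulrn ?normr_ge0// /f patchE mem_set//.
move: (normr_ge0 (u t i 0)); move: (`|u t i 0|) => v v0.
rewrite ger0_norm ?addr_ge0 ?sqr_ge0//.
have := sqr_ge0 (v - 1); rewrite sqrrB1; lra.
Qed.

Lemma weak_derivative_mxint (x y : R -> 'cV[R]_n) : {within I, continuous x} ->
  weak_derivative a b x y -> forall t, t \in `[a, b] ->
  x t = x a + J (fun s => ind s t *: y s).
Proof.
move=> cx [y2 xy] t tI; apply/matrixP => i j; rewrite ord1 mxE mxintE ?ltW//.
have cxi : {within I, continuous (fun t => x t i 0)}.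
  have ci : continuous (fun A : 'cV[R]_n => A i 0) by exact: coord_continuous.
  move=> s; exact: (@continuous_comp (subspace I) 'cV[R]_n R x (fun A => A i 0) s (cx
    s) (ci _)).
rewrite (weak_derivative_integral hab cxi (in_L2_integrable y2 i 0) _ tI).
  by congr (_ + _); apply: eq_Rintegral => s _; rewrite mxE.
move=> phi /xy /matrixP /(_ i 0); rewrite mxE !mxintE ?ltW//.
under eq_Rintegral do rewrite mxE.
by move=> ->; congr (- _); apply: eq_Rintegral => s _; rewrite mxE.
Qed.

Lemma mxint_cst p q (A : 'M[R]_(p, q)) (c d : R) : c <= d ->
  mxint c d (fun=> A) = (d - c) *: A.
Proof.
move=> cd; apply/matrixP => i j; rewrite mxintE// mxE Rintegral_cst//.
rewrite /= lebesgue_measure_itv/= mulrC; congr (_ * _); case: ifP => //=.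
by rewrite lte_fin => /negbT; rewrite -leNgt => dc; apply/esym/eqP;
  rewrite subr_eq0 eq_le dc.
Qed.

Context (B : 'M[R]_(n + n, n + (n + (n + n)))) (hB2 : B2 a b B \in unitmx).
Context (x xs xss : R -> 'cV[R]_n).
Context (hxs : weak_derivative a b x xs) (hxss : weak_derivative a b xs xss).
Context (cx : {within I, continuous x}) (cxs : {within I, continuous xs}).
Context (hbc : B *m col_mx (x a) (col_mx (x b) (col_mx (xs a) (xs b))) = 0).

Let ab : a <= b := ltW hab.
Let iu : integrable_mx a b xss := in_L2_integrable hxss.1.
Let mI : measurable I. Proof. exact: measurable_itv. Qed.

Let bind (t : R) : t \in `[a, b] -> bounded_measurable I (fun s => ind s t).
Proof.
by move=> tI; apply: bounded_measurable_coordinate_le;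
  [exact: coordinate_id|exact: (coordinate_cst _ tI)].
Qed.

Let integrable_mxZ (f : R -> R) (u : R -> 'cV[R]_n) : bounded_measurable I f ->
  integrable_mx a b u -> integrable_mx a b (fun t => f t *: u t).
Proof.
move=> bf ju; have -> : (fun t => f t *: u t) = (fun t => (f t)%:M *m u t).
  by apply/funext => t; rewrite mul_scalar_mx.
apply: integrable_mxM => // i j.
have [->|ij] := eqVneq i j.
  by apply: eq_bounded_measurable bf => t _; rewrite mxE eqxx mulr1n.
by apply: eq_bounded_measurable (bounded_measurable_cst I 0) => t _;
  rewrite mxE (negbTE ij).
Qed.

(** The integral formula for [xs] is inserted into the one for [x]. On the triangle [e <= s <= t]
    the integral over [s] has length [t - e], which is the Taylor weight. *)
Lemma Taylor_mxint (t : R) : t \in `[a, b] ->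
  x t = x a + (t - a) *: xs a + J (fun e => (ind e t * (t - e)) *: xss e).
Proof.
move=> tI; have := tI; rewrite in_itv/= => /andP[at_ tb].
pose K (s e : R) : 'M[R]_n := (ind s t * ind e s) *: 1%:M.
have bK : bounded_measurable_mx (I `*` I) (fun z => K z.1 z.2).
  apply: bounded_measurable_mxZ; last exact: bounded_measurable_mx_cst.
  apply: bounded_measurableM; apply: bounded_measurable_coordinate_le.
  - exact: coordinate1.
  - exact: (coordinate_cst _ tI).
  - exact: coordinate2.
  - exact: coordinate1.
rewrite (weak_derivative_mxint cx hxs tI) -addrA; congr (_ + _).
transitivity (J (fun s => ind s t *: xs a) +
    J (fun s => J (fun e => K s e *m xss e))).
  rewrite -mxintD//; last 2 first.
  - apply: integrable_mxZ; first exact: bind.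
    exact/bounded_measurable_integrable_mx/bounded_measurable_mx_cst.
  - apply: bounded_measurable_integrable_mx.
    exact: (bounded_measurable_mxint hab mI bK iu).
  apply: eq_mxint => // s sI; rewrite (weak_derivative_mxint cxs hxss sI) scalerDr.
  congr (_ + _); rewrite -mxintZ//; last by apply: integrable_mxZ => //; exact: bind.
  by apply: eq_mxint => // e _; rewrite scalerA /K -scalemxAl mul1mx.
congr (_ + _); first by rewrite -(mxint_indicatorl hab _ tI) mxint_cst.
rewrite (mxint_Fubini hab bK iu).
apply: eq_mxint => // e eI; have := eI; rewrite in_itv/= => /andP[ae eb].
rewrite -[RHS]mul_scalar_mx -scalemx1; congr (_ *m _).
have [et|te] := leP e t.
  rewrite mul1r -mxint_cst// (mxint_indicator hab _ ae et tb).
  by apply: eq_mxint => // s _; rewrite scalerA mulrC.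
rewrite mul0r scale0r.
have -> : K^~ e = fun=> 0 *: 0.
  apply/funext => s; rewrite scale0r /K.
  case: (leP e s) => es; last by rewrite mulr0 scale0r.
  by rewrite [s <= t]leNgt (lt_le_trans te es) mul0r scale0r.
by rewrite mxintZ ?scale0r//;
  apply/bounded_measurable_integrable_mx/bounded_measurable_mx_cst.
Qed.

(** The remainders at [b]: [p] in the expansion of [x], and [q] in that of [xs]. *)
Let p := J (fun e => (b - e) *: xss e).
Let q := J xss.

Let bI : b \in `[a, b]. Proof. by rewrite in_itv/= lexx andbT. Qed.

(** Expressing the values at [b] through those at [a] and the remainders turns the boundary
    condition into a linear system for [x a] and [xs a] with matrix [B2], whose solution is given by
    [B3]. *)
Lemma boundary_values : col_mx (x a) (xs a) = B3 a b B *m col_mx p q.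
Proof.
have xb : x b = x a + (b - a) *: xs a + p.
  rewrite (Taylor_mxint bI); congr (_ + _); apply: eq_mxint => // e.
  by rewrite in_itv/= => /andP[_ ->]; rewrite mul1r.
have xsb : xs b = xs a + q.
  rewrite (weak_derivative_mxint cxs hxss bI); congr (_ + _); apply: eq_mxint => // e.
  by rewrite in_itv/= => /andP[_ ->]; rewrite scale1r.
have H : B2 a b B *m col_mx (x a) (xs a) + B *m
     col_mx (row_mx 0 0) (col_mx (row_mx 1%:M 0) (col_mx (row_mx 0 0) (row_mx 0 1%:M)))
     *m col_mx p q = 0.
  rewrite -[RHS]hbc /B2 -!mulmxA -mulmxDr; congr (_ *m _).
  rewrite !mul_col_mx !mul_row_col !mul1mx !mul0mx mul_scalar_mx !add_col_mx.
  by rewrite !addr0 !add0r -xb -xsb.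
rewrite -[LHS](mulKmx hB2); move/eqP: H; rewrite addr_eq0 => /eqP ->.
by rewrite /B3 mulmxN mulNmx !mulmxA.
Qed.

(** [Ba] and [Bb] have this form in their last variable, so integrating them against [xss] gives a
    block row applied to [p] and [q]. *)
Lemma mxint_row (A1 A2 : 'M[R]_n) :
  J (fun e => ((b - e) *: A1 + A2) *m xss e) = A1 *m p + A2 *m q.
Proof.
have ip : integrable_mx a b (fun e => (b - e) *: xss e).
  apply: integrable_mxZ => //; apply: bounded_measurable_coordinateB.
    exact: (coordinate_cst _ bI).
  exact: coordinate_id.
rewrite -!mxintMl// -mxintD//.
- by apply: eq_mxint => // e _; rewrite mulmxDl -scalemxAl -scalemxAr.
- by apply: integrable_mxM => //; exact: bounded_measurable_mx_cst.
- by apply: integrable_mxM => //; exact: bounded_measurable_mx_cst.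
Qed.

Lemma xs_kernel (s : R) : s \in `[a, b] -> xs s = J (fun e => xsk a b B s e *m xss e).
Proof.
move=> sI; rewrite (weak_derivative_mxint cxs hxss sI).
have -> : xs a = J (fun e => Bb a b B e *m xss e).
  rewrite mxint_row -mul_row_col hsubmxK -mulmxA -boundary_values mul_row_col.
  by rewrite mul0mx mul1mx add0r.
rewrite addrC -mxintD//; last 2 first.
- by apply: integrable_mxZ => //; exact: bind.
- by apply: integrable_mxM => //; exact: bounded_measurable_Bb.
by apply: eq_mxint => // e _; rewrite [RHS]mulmxDl -scalemxAl mul1mx.
Qed.

Lemma x_kernel (s : R) : s \in `[a, b] -> x s = J (fun e => xk a b B s e *m xss e).
Proof.
move=> sI; rewrite (Taylor_mxint sI).
(* The row [[I, (s - a) I]] in the definition of [Ba] is exactly the affine part of Taylor's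
   formula. *)
have -> : x a + (s - a) *: xs a = J (fun e => Ba a b B s e *m xss e).
  rewrite mxint_row -mul_row_col hsubmxK -mulmxA -boundary_values mul_row_col.
  by rewrite mul1mx mul_scalar_mx.
rewrite addrC -mxintD//; last 2 first.
- apply: integrable_mxZ => //; apply: bounded_measurableM; first exact: bind.
  apply: bounded_measurable_coordinateB; first exact: (coordinate_cst _ sI).
  exact: coordinate_id.
- apply: integrable_mxM => //.
  apply: (bounded_measurable_mx_comp2 (K := Ba a b B) (g := fun=> s) (h := fun e => e) mI).
  + exact: bounded_measurable_Ba.
  + exact: (coordinate_cst _ sI).
  + exact: coordinate_id.
by apply: eq_mxint => // e _; rewrite [RHS]mulmxDl -scalemxAl mul1mx.
Qed.

End BoundaryConditions.

Theorem lemma5 (R : realType) (n : nat) (a b : R)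
    (B : 'M[R]_(n + n, n + (n + (n + n))))
    (M : R -> 'M[R]_n) (N1 N2 : R -> R -> 'M[R]_n)
    (x xs xss : R -> 'cV[R]_n)
    (hab : a < b) (hn : (1 <= n)%N)
    (* B has row rank 2n, and the inverse in the definition of B_3 exists *)
    (hB : \rank B = (2 * n)%N) (hB2 : B2 a b B \in unitmx)
    (hM : bounded_measurable1 a b M)
    (hN1 : bounded_measurable2 a b N1) (hN2 : bounded_measurable2 a b N2)
    (* x and x_s are the continuous representatives, x_ss is any representative *)
    (hx : sobolev a b 3 x)
    (hxs : weak_derivative a b x xs) (hxss : weak_derivative a b xs xss)
    (cx : {within `[a, b], continuous x})
    (cxs : {within `[a, b], continuous xs})
    (hbc : B *m col_mx (x a) (col_mx (x b) (col_mx (xs a) (xs b))) = 0) :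
  inner_L2 a b x (pi_op a b M N1 N2 xs)
  = inner_L2 a b xss
      (pi_op a b (fun=> 0) (Q1 a b B M N1 N2) (Q2 a b B M N1 N2) xss).
Proof.
have iu := in_L2_integrable hxss.1.
have xE := x_kernel hab hB2 hxs hxss cx cxs hbc.
have xsE := xs_kernel hab hB2 hxs hxss cx cxs hbc.
have PE s (sI : s \in `[a, b]) := pi_op_kernel hab hM hN1 hN2 iu sI xsE.
rewrite (inner_L2_kernel hab hM hN1 hN2 iu xE PE).
apply: eq_Rintegral => xi; rewrite mem_setE => xiI.
by rewrite (pi_op_Q hab B hM hN1 hN2 iu xiI).
Qed.
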